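(* Let $\mathcal{A}$ be a $C^*$-algebra, $X$ a Hilbert $C^*$-module over $\mathcal{A}$, and $\mu$ a probability measure on $\Omega$. Let $f,g\in L_2(\Omega,X)$ and suppose there exist vectors $x,x',y,y'\in X$ such that $$\int_{\Omega}\mathrm{Re}\langle x'-f(t),f(t)-x\rangle\,d\mu(t)\ge 0,\qquad \int_{\Omega}\mathrm{Re}\langle y'-g(t),g(t)-y\rangle\,d\mu(t)\ge 0$$ or, equivalently, $$\int_{\Omega}\left|f(t)-\tfrac{x'+x}{2}\right|^2d\mu(t)\le\tfrac14|x'-x|^2,\qquad \int_{\Omega}\left|g(t)-\tfrac{y'+y}{2}\right|^2d\mu(t)\le\tfrac14|y'-y|^2$$ (inequalities between self-adjoint elements of $\mathcal{A}$). Then $$\left\|\int_{\Omega}\langle f(t),g(t)\rangle\,d\mu(t)-\left\langle\int_{\Omega}f(t)\,d\mu(t),\int_{\Omega}g(t)\,d\mu(t)\right\rangle\right\|$$ $$\le\left\|\int_{\Omega}|f(t)|^2d\mu(t)-\left|\int_{\Omega}f(t)\,d\mu(t)\right|^2\right\|^{1/2}\left\|\int_{\Omega}|g(t)|^2d\mu(t)-\left|\int_{\Omega}g(t)\,d\mu(t)\right|^2\right\|^{1/2}$$ $$\le\left\|\tfrac14|x'-x|^2-\int_{\Omega}\mathrm{Re}\langle x'-f(t),f(t)-x\rangle\,d\mu(t)\right\|^{1/2}\left\|\tfrac14|y'-y|^2-\int_{\Omega}\mathrm{Re}\langle y'-g(t),g(t)-y\rangle\,d\mu(t)\right\|^{1/2}$$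 $$\le\tfrac14\|x'-x\|\,\|y'-y\|.$$ Moreover, the coefficient $1$ in the second inequality (the implicit factor in front of the third expression of the chain) and the constant $\tfrac14$ in the last inequality are sharp, in the sense that neither can be replaced by a smaller constant so that the corresponding inequality remains valid for all $\mathcal{A},X,\Omega,\mu,f,g,x,x',y,y'$ satisfying the hypotheses.
   Context: A Hilbert $C^*$-module over a $C^*$-algebra $\mathcal{A}$ is a right $\mathcal{A}$-module $X$ with a map $\langle\cdot,\cdot\rangle:X\times X\to\mathcal{A}$ satisfying: $\langle x,y+z\rangle=\langle x,y\rangle+\langle x,z\rangle$; $\langle x,ya\rangle=\langle x,y\rangle a$ for $a\in\mathcal{A}$; $\langle x,y\rangle^*=\langle y,x\rangle$; $\langle x,x\rangle\ge0$; $\langle x,x\rangle=0$ implies $x=0$; and $X$ is complete in the norm $\|x\|=\|\langle x,x\rangle\|^{1/2}$. The inner product is linear in the second variable and conjugate-linear in the first. Notation: $|x|=\langle x,x\rangle^{1/2}\in\mathcal{A}$, so $|x|^2=\langle x,x\rangle$; for $a\in\mathcal{A}$, $\mathrm{Re}\,a=\frac12(a+a^* )$; $\le$ between self-adjoint elements of $\mathcal{A}$ is the usual $C^*$-algebra order. For a probability measure $\mu$ on $\Omega$, $L_2(\Omega,X)$ is the set of all strongly measurable functions $f:\Omega\to X$ with $\|f\|_2^2:=\int_\Omega\|f(s)\|^2d\mu(s)<\infty$. All integrals of $X$-valued or $\mathcal{A}$-valued functions are Bochner integrals. *)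

(* Defs.v *)
From HB Require Import structures.
From mathcomp Require Import all_boot all_order all_algebra.
From mathcomp Require Import complex.
From mathcomp Require Import all_classical all_reals all_analysis.

Set Implicit Arguments.
Unset Strict Implicit.
Unset Printing Implicit Defensive.

Import Order.TTheory GRing.Theory Num.Theory.
Import numFieldNormedType.Exports.

Local Open Scope classical_set_scope.
Local Open Scope complex_scope.
Local Open Scope ring_scope.

(* C*-algebras are not assumed to have a unit, and MathComp has no non-unital
   rings: the product is therefore part of the interface.  Norms of normed
   R[i]-modules take their values in R[i]. *)
HB.mixin Record CompleteNormedModule_isCStarAlgebra (R : realType) A
    of CompleteNormedModule R[i] A := {
  cmul : A -> A -> A ;
  cstar : A -> A ;
  cmulA : forall a b c, cmul a (cmul b c) = cmul (cmul a b) c ;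
  cmulDl : forall a b c, cmul (a + b) c = cmul a c + cmul b c ;
  cmulDr : forall a b c, cmul a (b + c) = cmul a b + cmul a c ;
  cmulZl : forall (l : R[i]) a b, cmul (l *: a) b = l *: cmul a b ;
  cmulZr : forall (l : R[i]) a b, cmul a (l *: b) = l *: cmul a b ;
  cmul_norm : forall a b, `|cmul a b| <= `|a| * `|b| ;
  cstarK : forall a, cstar (cstar a) = a ;
  cstarD : forall a b, cstar (a + b) = cstar a + cstar b ;
  cstarZ : forall (l : R[i]) a, cstar (l *: a) = l^* *: cstar a ;
  cstarM : forall a b, cstar (cmul a b) = cmul (cstar b) (cstar a) ;
  cstar_norm : forall a, `|cmul (cstar a) a| = `|a| ^+ 2
}.

#[short(type="cstarAlgType")]
HB.structure Definition CStarAlgebra (R : realType) :=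
  {A of CompleteNormedModule R[i] A
      & CompleteNormedModule_isCStarAlgebra R A}.

(* The positive cone {b^* b}, which induces the usual order on A. *)
Definition cpos (R : realType) (A : cstarAlgType R) (a : A) : Prop :=
  exists b : A, a = cmul (cstar b) b.

Definition cle (R : realType) (A : cstarAlgType R) (a b : A) : Prop :=
  cpos (b - a).

Definition cRe (R : realType) (A : cstarAlgType R) (a : A) : A :=
  (2^-1 : R[i]) *: (a + cstar a).

(* Completeness in the norm ||<x, x>||^(1/2) is expressed by asking that X be
   a complete normed module whose norm is that one (field ip_norm). *)
HB.mixin Record CompleteNormedModule_isHilbertModule (R : realType)
    (A : cstarAlgType R) X of CompleteNormedModule R[i] X := {
  ract : X -> A -> X ;
  ip : X -> X -> A ;
  ractDl : forall x y a, ract (x + y) a = ract x a + ract y a ;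
  ractDr : forall x a b, ract x (a + b) = ract x a + ract x b ;
  ractM : forall x a b, ract x (cmul a b) = ract (ract x a) b ;
  ractZl : forall (l : R[i]) x a, ract (l *: x) a = l *: ract x a ;
  ractZr : forall (l : R[i]) x a, ract x (l *: a) = l *: ract x a ;
  ipDr : forall x y z, ip x (y + z) = ip x y + ip x z ;
  ipZr : forall (l : R[i]) x y, ip x (l *: y) = l *: ip x y ;
  ip_ract : forall x y a, ip x (ract y a) = cmul (ip x y) a ;
  ip_star : forall x y, cstar (ip x y) = ip y x ;
  ip_ge0 : forall x, cpos (ip x x) ;
  ip_eq0 : forall x, ip x x = 0 -> x = 0 ;
  ip_norm : forall x, `|x| ^+ 2 = `|ip x x|
}.

#[short(type="hilbertModType")]
HB.structure Definition HilbertModule (R : realType) (A : cstarAlgType R) :=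
  {X of CompleteNormedModule R[i] X
      & CompleteNormedModule_isHilbertModule R A X}.

(* |x|^2, where |x| is the square root of <x, x> in A *)
Definition absq (R : realType) (A : cstarAlgType R) (X : hilbertModType A)
    (x : X) : A := ip x x.

(* the norm as an element of R, to be used in integrals and square roots *)
Definition normR (R : realType) (E : normedModType R[i]) (v : E) : R :=
  complex.Re `|v|.

Definition simple_fun d (T : measurableType d) (E : Type) (s : T -> E) : Prop :=
  finite_set (range s) /\ forall v, measurable (s @^-1` [set v]).

Definition simple_integral (R : realType) d (T : measurableType d)
    (P : probability T R) (E : normedModType R[i]) (s : T -> E) : E :=
  \sum_(v \in range s) (fine (P (s @^-1` [set v])))%:C *: v.

(* Almost everywhere limit of simple functions.  The scalar function ||f t|| is
   then measurable only up to a null set; the library integral of a nonnegative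
   function is a supremum over measurable simple minorants, so that it does
   not depend on the values taken on a null set. *)
Definition strongly_measurable (R : realType) d (T : measurableType d)
    (P : probability T R) (E : normedModType R[i]) (f : T -> E) : Prop :=
  exists s : nat -> T -> E, (forall n, simple_fun (s n)) /\
    {ae P, forall t, s n t @[n --> \oo] --> f t}.

Definition is_bochner_integral (R : realType) d (T : measurableType d)
    (P : probability T R) (E : normedModType R[i]) (f : T -> E) (v : E) : Prop :=
  strongly_measurable P f /\
  exists s : nat -> T -> E,
    [/\ forall n, simple_fun (s n),
        (\int[P]_t (normR (f t - s n t))%:E)%E @[n --> \oo] --> 0%E
      & simple_integral P (s n) @[n --> \oo] --> v].

(* The value is 0 when f is not Bochner integrable. *)
Definition bochner (R : realType) d (T : measurableType d)
    (P : probability T R) (E : normedModType R[i]) (f : T -> E) : E :=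
  xget 0 [set v | is_bochner_integral P f v].

Definition L2 (R : realType) d (T : measurableType d)
    (P : probability T R) (E : normedModType R[i]) (f : T -> E) : Prop :=
  strongly_measurable P f /\ (\int[P]_t (normR (f t) ^+ 2)%:E < +oo)%E.

Section GrussTerms.
Context (R : realType) d (T : measurableType d) (P : probability T R)
  (A : cstarAlgType R) (X : hilbertModType A).
Implicit Types (f g : T -> X) (x y : X).

Definition cov f g : A :=
  bochner P (fun t => ip (f t) (g t)) - ip (bochner P f) (bochner P g).

Definition variance f : A :=
  bochner P (fun t => absq (f t)) - absq (bochner P f).

Definition re_integral x x' f : A :=
  bochner P (fun t => cRe (ip (x' - f t) (f t - x))).

Definition sqdist_integral x x' f : A :=
  bochner P (fun t => absq (f t - (2^-1 : R[i]) *: (x' + x))).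

Definition variance_bound f g : R :=
  Num.sqrt (normR (variance f)) * Num.sqrt (normR (variance g)).

Definition defect_bound x x' y y' f g : R :=
  Num.sqrt (normR ((4^-1 : R[i]) *: absq (x' - x) - re_integral x x' f)) *
  Num.sqrt (normR ((4^-1 : R[i]) *: absq (y' - y) - re_integral y y' g)).

End GrussTerms.

(* Main.v *)
(* Write E f for the integral of f.  The A-valued form
   [f, g] = E <f, g> - <E f, E g> = E <f - E f, g - E g> is a semi-inner product
   on L_2, so the first inequality is its Cauchy-Schwarz inequality.  With
   m = (x + x') / 2, integrating
     Re <x' - f, f - x> = |x' - x|^2 / 4 - |f - m|^2
   gives both the equivalence of the hypotheses and
     [f, f] <= [f, f] + |E f - m|^2 = E |f - m|^2
            = |x' - x|^2 / 4 - E Re <x' - f, f - x> <= |x' - x|^2 / 4,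
   and the norm is monotone on positive elements.  For f = g = 1 or -1 with
   probability 1/2, x = -1 and x' = 1, the last two inequalities are equalities.

   The order on A is handled without spectrum or functional calculus: u is
   positive if |T - u| <= T + o(1) for large real T, an additive and closed
   condition.  Square roots are replaced by the fixed-point iteration
   V -> (u + V^2) / 2, which gives (1 - V)^2 ~ 1 - u. *)

Require Import Defs.
From HB Require Import structures.
From mathcomp Require Import all_boot all_order all_algebra.
From mathcomp Require Import complex finmap ring lra.
From mathcomp Require Import all_classical all_reals all_analysis.
From mathcomp Require Import measurable_realfun.
Import Order.TTheory GRing.Theory Num.Theory.
Import numFieldNormedType.Exports.

Set Implicit Arguments.
Unset Strict Implicit.
Unset Printing Implicit Defensive.

Local Open Scope classical_set_scope.
Local Open Scope complex_scope.
Local Open Scope ring_scope.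

(** Nothing is known beforehand about sums of elements [b^* b], nor about the norm on them; this is
    the obstacle. Only one implication is proved: [b^* b] is positive in the asymptotic sense. No
    positive element is ever factored back as [b^* b], because the equivalence of the hypotheses
    reduces to an equality in [A] and the conclusions are norm inequalities. For commuting
    self-adjoint K, J everything rests on (K - i J) (K + i J) = K^2 + J^2 and the C*-identity.
    Monotonicity of the norm needs no more, since a commutes with |a + c| - a. For [b^* b] itself,
    the sum [b b^* + b^* b] is a sum of self-adjoint squares, and bounds on [t - b b^*] pass to
    [t - b^* b] by comparing high powers. The resulting crude lower bound on [b^* b] is then
    improved indefinitely by means of a cubic polynomial. As [A] may lack a unit, scalars live in
    its unitization, whose elements are measured only by bounds on their left action on [A]. *)

Section NormR.
Context (R : realType) (E : normedModType R[i]).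
Implicit Types (v w : E) (r : R).

Lemma normRE v : (normR v)%:C = `|v|.
Proof. by rewrite /normR RRe_real// ger0_real. Qed.

Lemma normR_ge0 v : 0 <= normR v.
Proof. by rewrite -lecR normRE normr_ge0. Qed.

Lemma normR0 : normR (0 : E) = 0.
Proof. by rewrite /normR normr0. Qed.

Lemma normR_eq0 v : normR v = 0 -> v = 0.
Proof. by move=> v0; apply/eqP; rewrite -normr_eq0 -normRE v0. Qed.

Lemma normRD v w : normR (v + w) <= normR v + normR w.
Proof. by rewrite -lecR rmorphD/= !normRE ler_normD. Qed.

Lemma normRN v : normR (- v) = normR v.
Proof. by rewrite /normR normrN. Qed.

Lemma normRB v w : normR (v - w) <= normR v + normR w.
Proof. by rewrite -(normRN w) normRD. Qed.

Lemma normR_distC v w : normR (v - w) = normR (w - v).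
Proof. by rewrite /normR distrC. Qed.

Lemma normRZc (l : R[i]) v : normR (l *: v) = complex.Re `|l| * normR v.
Proof.
by apply: (@complexI R); rewrite rmorphM/= !normRE normrZ; congr (_ * _).
Qed.

Lemma normRZ r v : normR (r%:C *: v) = `|r| * normR v.
Proof. by rewrite normRZc normc_def/= expr0n/= addr0 sqrtr_sqr. Qed.

Lemma ler_normRB v w : `|normR v - normR w| <= normR (v - w).
Proof.
rewrite ler_norml lerBlDr lerNl opprB lerBlDr; apply/andP; split.
  by rewrite -{1}(subrK v w) normR_distC normRD.
by rewrite -{1}(subrK w v) normRD.
Qed.

End NormR.

(** * Unitization *)

Section CStar.
Context (R : realType) (A : cstarAlgType R).
Implicit Types a b c : A.

Lemma cmul0l a : cmul 0 a = 0.
Proof. by apply: (@addrI _ (cmul 0 a)); rewrite -cmulDl !addr0. Qed.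

Lemma cmul0r a : cmul a 0 = 0.
Proof. by apply: (@addrI _ (cmul a 0)); rewrite -cmulDr !addr0. Qed.

Lemma cstar0 : cstar (0 : A) = 0.
Proof. by apply: (@addrI _ (cstar 0)); rewrite -cstarD !addr0. Qed.

Lemma cstarN a : cstar (- a) = - cstar a.
Proof. by apply: (@addrI _ (cstar a)); rewrite -cstarD !subrr cstar0. Qed.

Lemma cmul_normR a b : normR (cmul a b) <= normR a * normR b.
Proof. by rewrite -lecR rmorphM/= !normRE cmul_norm. Qed.

Lemma cstar_normR a : normR (cmul (cstar a) a) = normR a ^+ 2.
Proof. by apply: (@complexI R); rewrite rmorphXn/= !normRE cstar_norm. Qed.

(** From |b|^2 = |b^* b| <= |b^*| |b|, used for both a and its adjoint. *)
Lemma normR_star a : normR (cstar a) = normR a.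
Proof.
have H b : normR b <= normR (cstar b).
  have [->//|b0] := eqVneq (normR b) 0; first exact: normR_ge0.
  have bp : 0 < normR b by rewrite lt_neqAle eq_sym b0 normR_ge0.
  by rewrite -(ler_pM2r bp) -expr2 -cstar_normR cmul_normR.
by apply/eqP; rewrite eq_le H -{2}(cstarK a) H.
Qed.

End CStar.

Definition unitization (R : realType) (A : cstarAlgType R) : Type :=
  (R[i] * A)%type.
HB.instance Definition _ (R : realType) (A : cstarAlgType R) :=
  GRing.Zmodule.on (unitization A).

Section UnitizationRing.
Context (R : realType) (A : cstarAlgType R).
Local Notation U := (unitization A).

Definition umul (u v : U) : U :=
  (u.1 * v.1, u.1 *: v.2 + v.1 *: u.2 + cmul u.2 v.2).

Lemma umulA : associative umul.
Proof.
move=> [l a] [m b] [n c]; congr pair => /=; first by rewrite mulrA.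
rewrite !scalerDr !cmulDr !cmulDl !cmulZl !cmulZr !scalerA cmulA.
rewrite (mulrC n l) (mulrC n m) !addrA.
by rewrite [LHS](ACl (1*2*4*6*3*5*7)).
Qed.

Lemma umul1l : left_id ((1, 0) : U) umul.
Proof.
by move=> [l a]; rewrite /umul/= mul1r scale1r scaler0 cmul0l !addr0.
Qed.

Lemma umul1r : right_id ((1, 0) : U) umul.
Proof.
by move=> [l a]; rewrite /umul/= mulr1 scale1r scaler0 cmul0r addr0 add0r.
Qed.

Lemma umulDl : left_distributive umul +%R.
Proof.
move=> [l a] [m b] [n c]; congr pair => /=; first by rewrite mulrDl.
by rewrite !scalerDr !cmulDl !scalerDl !addrA [LHS](ACl (1*3*5*2*4*6)).
Qed.

Lemma umulDr : right_distributive umul +%R.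
Proof.
move=> [l a] [m b] [n c]; congr pair => /=; first by rewrite mulrDr.
by rewrite !scalerDr !cmulDr !scalerDl !addrA [LHS](ACl (1*3*5*2*4*6)).
Qed.

Lemma umul1_neq0 : ((1, 0) : U) != 0.
Proof. by apply/eqP => -[] /eqP; rewrite oner_eq0. Qed.

HB.instance Definition _ := GRing.Zmodule_isNzRing.Build (unitization A)
  umulA umul1l umul1r umulDl umulDr umul1_neq0.

End UnitizationRing.

Section Unitization.
Context (R : realType) (A : cstarAlgType R).
Local Notation U := (unitization A).
Implicit Types (u v w Q L S : U) (a b c x y : A) (r s t M T : R).

Definition scl r : U := (r%:C, 0).

Lemma scl_is_additive : {morph scl : x y / x - y}.
Proof. by move=> r s; congr pair; rewrite /= ?rmorphB ?subr0. Qed.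

Lemma scl_is_multiplicative : monoid_morphism scl.
Proof.
split => // r s; congr pair; rewrite /= ?rmorphM//.
by rewrite !scaler0 cmul0l !addr0.
Qed.

HB.instance Definition _ := GRing.isZmodMorphism.Build R U scl scl_is_additive.
HB.instance Definition _ :=
  GRing.isMonoidMorphism.Build R U scl scl_is_multiplicative.

Lemma sclC r u : scl r * u = u * scl r.
Proof.
case: u => l a; congr pair; rewrite /= ?(mulrC l)//.
by rewrite !scaler0 cmul0l cmul0r !addr0 add0r.
Qed.

(** The unitization is given only a ring structure, so the imaginary unit, like the real scalars
    [scl r], is a central element of it. *)
Definition ui : U := ('i, 0).

Lemma uiC u : ui * u = u * ui.
Proof.
case: u => l a; congr pair; rewrite /= ?(mulrC l)//.
by rewrite !scaler0 cmul0l cmul0r !addr0 add0r.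
Qed.

Lemma ui_sqr : ui * ui = -1.
Proof.
congr pair; rewrite /= ?scaler0 ?cmul0l ?addr0 ?oppr0//.
by rewrite -expr2 sqr_i.
Qed.

Definition emb a : U := (0, a).

Lemma emb_is_additive : {morph emb : x y / x - y}.
Proof. by move=> a b; congr pair; rewrite /= subr0. Qed.

HB.instance Definition _ := GRing.isZmodMorphism.Build A U emb emb_is_additive.

Lemma embM a b : emb (cmul a b) = emb a * emb b.
Proof. by congr pair; rewrite /= ?mul0r// !scale0r !add0r. Qed.

Lemma embZ r a : emb (r%:C *: a) = scl r * emb a.
Proof. by congr pair; rewrite /= ?mulr0// scaler0 cmul0l !addr0. Qed.

Definition star u : U := (u.1^*, cstar u.2).

Lemma star_is_additive : {morph star : x y / x - y}.
Proof.
move=> [l a] [m b]; congr pair; rewrite /= ?rmorphB//.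
by rewrite cstarD cstarN.
Qed.

HB.instance Definition _ := GRing.isZmodMorphism.Build U U star star_is_additive.

Lemma starM u v : star (u * v) = star v * star u.
Proof.
case: u v => l a [m b]; congr pair => /=; first by rewrite rmorphM mulrC.
by rewrite !cstarD !cstarZ cstarM (addrC (l^* *: _)).
Qed.

Lemma starK u : star (star u) = u.
Proof. by case: u => l a; congr pair => /=; rewrite ?cstarK ?conjCK. Qed.

Lemma star_scl r : star (scl r) = scl r.
Proof.
congr pair; rewrite /= ?cstar0//.
by apply/eqP; rewrite eq_complex/= oppr0 !eqxx.
Qed.

Lemma star1 : star 1 = 1.
Proof. by rewrite -(rmorph1 scl) star_scl. Qed.

Lemma star_ui : star ui = - ui.
Proof.
congr pair; rewrite /= ?cstar0 ?oppr0//.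
by apply/eqP; rewrite eq_complex/= oppr0 !eqxx.
Qed.

Lemma star_emb a : star (emb a) = emb (cstar a).
Proof. by congr pair; rewrite /= conjC0. Qed.

Definition act u x : A := u.1 *: x + cmul u.2 x.

Lemma actM u v x : act (u * v) x = act u (act v x).
Proof.
rewrite /act /= cmulDl scalerDr scalerA -!addrA; congr (_ + _).
rewrite cmulDl !cmulZl cmulDr !cmulZr cmulA.
by rewrite -!addrA.
Qed.

Lemma actD u v x : act (u + v) x = act u x + act v x.
Proof. by rewrite /act/= scalerDl cmulDl addrACA. Qed.

Lemma actN u x : act (- u) x = - act u x.
Proof.
apply: (@addrI _ (act u x)); rewrite -actD !subrr /act/= scale0r.
by rewrite cmul0l addr0.
Qed.

Lemma act_scl r x : act (scl r) x = r%:C *: x.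
Proof. by rewrite /act/= cmul0l addr0. Qed.

Lemma act_emb a x : act (emb a) x = cmul a x.
Proof. by rewrite /act/= scale0r add0r. Qed.

(** With the [A]-valued inner product x^* y on [A], [star u] acts as the adjoint of [u]. *)
Lemma act_star u x y : cmul (cstar (act u x)) y = cmul (cstar x) (act (star u) y).
Proof.
rewrite /act/= cstarD cstarZ cstarM cmulDl cmulDr cmulZl cmulZr.
by rewrite cmulA.
Qed.

(* The operator seminorm of the left action on A.  It is a norm, and then the
   C*-norm of the unitization, only if A has no unit. *)
Definition nb u M := forall x, normR (act u x) <= M * normR x.

Lemma nb_le u M T : M <= T -> nb u M -> nb u T.
Proof.
by move=> MT uM x; rewrite (le_trans (uM x))// ler_wpM2r// normR_ge0.
Qed.

Lemma nbD u v M T : nb u M -> nb v T -> nb (u + v) (M + T).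
Proof.
by move=> uM vT x; rewrite actD mulrDl (le_trans (normRD _ _))// lerD.
Qed.

Lemma nbN u M : nb u M -> nb (- u) M.
Proof. by move=> uM x; rewrite actN normRN. Qed.

Lemma nbB u v M T : nb u M -> nb v T -> nb (u - v) (M + T).
Proof. by move=> uM vT; apply: nbD => //; apply: nbN. Qed.

Lemma nbBC u v M : nb (u - v) M -> nb (v - u) M.
Proof. by move=> /nbN; rewrite opprB. Qed.

Lemma nbM u v M T : 0 <= M -> nb u M -> nb v T -> nb (u * v) (M * T).
Proof.
move=> M0 uM vT x; rewrite actM (le_trans (uM _))// -mulrA.
by rewrite ler_wpM2l.
Qed.

Lemma nb_scl r : nb (scl r) `|r|.
Proof. by move=> x; rewrite act_scl normRZ. Qed.

Lemma nb0 : nb 0 0.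
Proof. by move=> x; rewrite -(raddf0 scl) act_scl scale0r normR0 mul0r. Qed.

Lemma nb_sclM r u M : 0 <= r -> nb u M -> nb (scl r * u) (r * M).
Proof.
by move=> r0 uM; apply: nbM => //; rewrite -{2}(ger0_norm r0); exact: nb_scl.
Qed.

Lemma nb_lim u M : (forall e, 0 < e -> nb u (M + e)) -> nb u M.
Proof.
move=> H x; have [x0|x0] := eqVneq (normR x) 0.
  by have := H 1 ltr01 x; rewrite x0 !mulr0.
have xp : 0 < normR x by rewrite lt_neqAle eq_sym x0 normR_ge0.
rewrite -ler_pdivrMr//; apply/ler_addgt0Pr => e e0.
by rewrite ler_pdivrMr// H.
Qed.

Lemma nb_ex u : exists2 M, 0 <= M & nb u M.
Proof.
exists (complex.Re `|u.1| + normR u.2).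
  by rewrite addr_ge0 ?normR_ge0// (@normR_ge0 R (R[i]^o)).
by move=> x; rewrite mulrDl (le_trans (normRD _ _))// normRZc lerD2l cmul_normR.
Qed.

(** The C*-identity of the operator seminorm: |u x|^2 = |x^* (u^* u x)| in [A]. *)
Lemma nb_starM u M : 0 <= M -> nb (star u * u) (M ^+ 2) -> nb u M.
Proof.
move=> M0 uM x; rewrite -ler_sqr ?nnegrE ?mulr_ge0 ?normR_ge0//.
rewrite -cstar_normR act_star (le_trans (cmul_normR _ _))// normR_star exprMn.
rewrite -actM expr2 mulrCA; rewrite expr2 in uM.
by apply: ler_wpM2l; rewrite ?normR_ge0// -expr2 -expr2.
Qed.

(** Divide |u^* x|^2 = |x^* (u u^* x)| <= |x| M |u^* x| by |u^* x|. *)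
Lemma nb_star u M : 0 <= M -> nb u M -> nb (star u) M.
Proof.
move=> M0 uM x; have [->|x0] := eqVneq (normR (act (star u) x)) 0.
  by rewrite mulr_ge0 ?normR_ge0.
have xp : 0 < normR (act (star u) x) by rewrite lt_neqAle eq_sym x0 normR_ge0.
rewrite -(ler_pM2r xp) -expr2 -cstar_normR act_star starK.
rewrite (le_trans (cmul_normR _ _))// normR_star mulrAC mulrC.
by rewrite ler_wpM2r ?normR_ge0.
Qed.

(** Test the action on a^*: |a|^2 = |a a^*| <= M |a^*|. *)
Lemma normR_emb a M : 0 <= M -> nb (emb a) M -> normR a <= M.
Proof.
move=> M0 aM; have [->//|a0] := eqVneq (normR a) 0.
have ap : 0 < normR a by rewrite lt_neqAle eq_sym a0 normR_ge0.
rewrite -(ler_pM2r ap) -expr2 -{1}(normR_star a) -cstar_normR cstarK.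
by rewrite -[leRHS](congr1 ( *%R M) (normR_star a)) -act_emb.
Qed.

Lemma nb_emb a : nb (emb a) (normR a).
Proof. by move=> x; rewrite act_emb cmul_normR. Qed.

Definition sa u := star u = u.

Lemma saD u v : sa u -> sa v -> sa (u + v).
Proof. by move=> su sv; rewrite /sa raddfD/= su sv. Qed.

Lemma saN u : sa u -> sa (- u).
Proof. by move=> su; rewrite /sa raddfN/= su. Qed.

Lemma saB u v : sa u -> sa v -> sa (u - v).
Proof. by move=> su sv; apply: saD => //; apply: saN. Qed.

Lemma sa_scl r : sa (scl r).
Proof. exact: star_scl. Qed.

Lemma saM u v : GRing.comm u v -> sa u -> sa v -> sa (u * v).
Proof. by rewrite /sa starM => c -> ->. Qed.

Lemma sa_sclM r u : sa u -> sa (scl r * u).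
Proof. by move=> su; apply: saM => //; [exact: sclC|exact: sa_scl]. Qed.

Lemma sa_sqr u : sa u -> sa (u * u).
Proof. by move=> su; apply: saM. Qed.

Lemma sa_conj u v : sa v -> sa (star u * v * u).
Proof. by rewrite /sa !starM starK mulrA => ->. Qed.

Lemma sa_starM u : sa (star u * u).
Proof. by rewrite -(mulr1 (star u)); apply: sa_conj; rewrite /sa star1. Qed.

(* First-order positivity, |T - u| <= T + o(1) as T goes to +oo: in this form
   the convexity of the cone is the triangle inequality. *)
Definition upos u :=
  sa u /\ forall e, 0 < e -> exists2 T, 0 <= T & nb (scl T - u) (T + e).

Lemma uposD u v : upos u -> upos v -> upos (u + v).
Proof.
move=> [su pu] [sv pv]; split => [|e e0]; first exact: saD.
have [T T0 uT] := pu _ (divr_gt0 e0 (ltr0Sn _ 1)).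
have [S S0 vS] := pv _ (divr_gt0 e0 (ltr0Sn _ 1)).
exists (T + S); first exact: addr_ge0.
rewrite raddfD opprD addrACA [e]splitr [T + S + _]addrACA.
exact: nbD.
Qed.

Lemma uposZ r u : 0 <= r -> upos u -> upos (scl r * u).
Proof.
rewrite le_eqVlt => /predU1P[<-|r0] [su pu].
  split => [|e e0]; rewrite raddf0 mul0r; first by rewrite -(raddf0 scl); exact: sa_scl.
  exists 0 => //; rewrite raddf0 subr0 add0r.
  by apply: nb_le nb0; exact: ltW.
split => [|e e0]; first exact: sa_sclM.
have [T T0 uT] := pu _ (divr_gt0 e0 r0).
exists (r * T); first by rewrite mulr_ge0// ltW.
rewrite rmorphM -mulrBr (_ : _ + e = r * (T + e / r)); last first.
  by rewrite mulrDr mulrCA divff ?mulr1// gt_eqF.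
by apply: nb_sclM => //; exact: ltW.
Qed.

Lemma upos_nb u M : 0 <= M -> sa u -> nb u M -> upos (scl M - u).
Proof.
move=> M0 su uM; split => [|e e0]; first by apply: saB => //; exact: sa_scl.
exists M => //; rewrite subKr; apply: nb_le uM; rewrite lerDl; exact: ltW.
Qed.

Lemma upos_scl r : 0 <= r -> upos (scl r).
Proof.
by move=> r0; rewrite -[scl r]subr0; apply: upos_nb => //;
  [rewrite -(raddf0 scl); exact: sa_scl|apply: nb_le nb0].
Qed.

Lemma upos_closed u : sa u ->
  (forall e, 0 < e -> exists2 v, upos v & nb (u - v) e) -> upos u.
Proof.
move=> su H; split => // e e0; have e20 : 0 < e / 2 by rewrite divr_gt0.
have [v [_ pv] uv] := H _ e20; have [T T0 vT] := pv _ e20.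
exists T => //; rewrite [e]splitr addrA -(subrKA v).
by apply: nbD => //; rewrite -opprB; exact: nbN.
Qed.

End Unitization.

(** * Approximate square roots and positivity of commuting elements *)

Section Positivity.
Context (R : realType) (A : cstarAlgType R).
Local Notation U := (unitization A).
Local Notation scl := (@scl R A).
Local Notation ui := (@ui R A).
Implicit Types (u v w Q L S K J : U) (a b c x y : A) (r s t M T : R).

Lemma scl_comm u r : GRing.comm u (scl r).
Proof. by rewrite /GRing.comm sclC. Qed.

(** Evaluation of real polynomials at [u]: identities between polynomials in one element are proved
    by [ring] in the commutative ring [{poly R}] and transported. *)
Definition ev u : {poly R} -> U := horner_morph (scl_comm u).
HB.instance Definition _ u := GRing.RMorphism.on (ev u).

Lemma evX u : ev u 'X = u.
Proof. exact: horner_morphX. Qed.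

Lemma evC u r : ev u r%:P = scl r.
Proof. exact: horner_morphC. Qed.

Fixpoint sqrt_iter u n : U :=
  if n is m.+1 then scl 2^-1 * (u + sqrt_iter u m * sqrt_iter u m) else 0.

Lemma sqrt_iter_sa u n : sa u -> sa (sqrt_iter u n).
Proof.
move=> su; elim: n => [|n IH] /=; first by rewrite -(raddf0 scl); exact: sa_scl.
by apply: sa_sclM; apply: saD => //; apply: sa_sqr.
Qed.

Lemma sqrt_iter_comm u n w : GRing.comm w u -> GRing.comm w (sqrt_iter u n).
Proof.
move=> wu; elim: n => [|n IH] /=; first exact: commr0.
by apply: commrM; [exact: scl_comm|apply: commrD => //; exact: commrM].
Qed.

Lemma sqrt_iter_nb u r n : 0 <= r < 1 -> nb u r -> nb (sqrt_iter u n) r.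
Proof.
move=> /andP[r0 r1] ur; elim: n => [|n IH] /=; first by apply: nb_le r0 _; exact: nb0.
apply: nb_le (nb_sclM _ (nbD ur (nbM r0 IH IH))); last by rewrite invr_ge0.
by nra.
Qed.

(** The iterates stay in the ball of radius r, where V -> (u + V^2) / 2 contracts by the factor r:
    V^2 - W^2 = V (V - W) + (V - W) W holds without commutation. *)
Lemma sqrt_iter_step u r n : 0 <= r < 1 -> nb u r ->
  nb (sqrt_iter u n.+1 - sqrt_iter u n) (r ^+ n.+1).
Proof.
move=> r01 ur; have /andP[r0 r1] := r01; elim: n => [|n IH].
  rewrite /= mul0r addr0 subr0; apply: nb_le (nb_sclM _ ur).
    by rewrite expr1; lra.
  by rewrite invr_ge0.
rewrite [sqrt_iter u n.+2]/= [X in _ - X]/= -/(sqrt_iter u n.+1).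
set V := sqrt_iter u n.+1 in IH *; set W := sqrt_iter u n in IH *.
have -> : scl 2^-1 * (u + V * V) - scl 2^-1 * (u + W * W) =
    scl 2^-1 * (V * (V - W) + (V - W) * W).
  rewrite -mulrBr opprD addrACA subrr add0r; congr (_ * _).
  by rewrite mulrBr mulrBl addrA subrK.
have nV : nb V r by exact: sqrt_iter_nb.
have nW : nb W r by exact: sqrt_iter_nb.
have r0n : 0 <= r ^+ n.+1 by rewrite exprn_ge0.
apply: nb_le (nb_sclM _ (nbD (nbM r0 nV IH) (nbM r0n IH nW))).
  by rewrite [r ^+ n.+2]exprS (mulrC _ r); lra.
by rewrite invr_ge0.
Qed.

(** For S = 1 - V the error S^2 - (1 - u) is exactly twice the next increment of the iteration, so
    no limit has to be formed. *)
Lemma sqrt_approx u r e : sa u -> 0 <= r < 1 -> nb u r -> 0 < e ->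
  exists S, [/\ sa S, forall w, GRing.comm w u -> GRing.comm w S
    & nb (S * S - (1 - u)) e].
Proof.
move=> su r01 ur e0; have /andP[r0 r1] := r01.
have [n rn] : exists n, r ^+ n.+1 < e / 2.
  have r1' : `|r| < 1 by rewrite ger0_norm.
  have /cvgrPdist_lt/(_ _ (divr_gt0 e0 (ltr0Sn _ 1)))[n _ /(_ n.+1 (leqnSn _))] :=
    cvg_expr r1'.
  by rewrite sub0r normrN ger0_norm ?exprn_ge0// => ?; exists n.
exists (1 - sqrt_iter u n); split.
- by apply: saB; [rewrite -(rmorph1 scl); exact: sa_scl|exact: sqrt_iter_sa].
- by move=> w wu; apply: commrB; [exact: commr1|exact: sqrt_iter_comm].
have -> : (1 - sqrt_iter u n) * (1 - sqrt_iter u n) - (1 - u) =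
    scl 2 * (sqrt_iter u n.+1 - sqrt_iter u n).
  rewrite /= [RHS]mulrBr mulrA -(rmorphM scl) divff ?pnatr_eq0// rmorph1 mul1r.
  rewrite mulrBl !mulrBr !mul1r !mulr1 !opprB rmorph_nat mulr_natl mulr2n !opprD.
  set V := sqrt_iter u n; rewrite !addrA.
  by rewrite [LHS](ACl (1*6*5*3*2*4))/= subrr add0r.
apply: nb_le (nb_sclM _ (sqrt_iter_step n r01 ur)) => //.
by rewrite mulrC -ler_pdivlMr// ltW.
Qed.

(** The root commutes with everything that commutes with Q, so that roots of commuting elements
    commute with each other. *)
Lemma upos_sqrt Q e : upos Q -> 0 < e ->
  exists S, [/\ sa S, forall w, GRing.comm w Q -> GRing.comm w S
    & nb (Q - S * S) e].
Proof.
move=> [sQ pQ] e0; have d0 : 0 < e / 4 by rewrite divr_gt0.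
have [T T0 QT] := pQ _ d0; set d := e / 4 in d0 QT.
(* Since |T - Q| <= T + d, u = (T - Q) / B has norm at most (T + d) / (T + 2 d) < 1, and B (1 - u) =
   Q + 2 d. The shift 2 d = e / 2 is half of the allowed error. *)
pose B := T + 2 * d; have B0 : 0 < B by rewrite /B; lra.
pose u := scl B^-1 * (scl T - Q).
have su : sa u by apply: sa_sclM; apply: saB => //; exact: sa_scl.
have Bi0 : 0 <= B^-1 by rewrite invr_ge0 ltW.
have ur : nb u (B^-1 * (T + d)) by apply: nb_sclM.
have r01 : 0 <= B^-1 * (T + d) < 1.
  rewrite mulr_ge0 ?addr_ge0 ?(ltW d0)//= mulrC ltr_pdivrMr// mul1r /B.
  by lra.
have [S [sS cS nS]] := sqrt_approx su r01 ur (divr_gt0 (divr_gt0 e0 (ltr0Sn _ 1)) B0).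
have q2 : Num.sqrt B * Num.sqrt B = B by rewrite -expr2 sqr_sqrtr// ltW.
exists (scl (Num.sqrt B) * S); split; first exact: sa_sclM.
  move=> w wQ; apply: commrM; first exact: scl_comm.
  apply: cS; apply: commrM; first exact: scl_comm.
  by apply: commrB => //; exact: scl_comm.
have -> : Q - scl (Num.sqrt B) * S * (scl (Num.sqrt B) * S) =
    scl B * ((1 - u) - S * S) - scl (2 * d).
  rewrite mulrA -(mulrA (scl _) S) -sclC mulrA -rmorphM/= q2 -mulrA.
  rewrite mulrBr addrAC; congr (_ - _).
  rewrite mulrBr mulr1 /u mulrA -rmorphM/= divff ?gt_eqF// rmorph1 mul1r.
  rewrite opprB addrA /B raddfD/=.
  by rewrite [RHS](ACl (3*1*4*2*5))/= !addrK.
have nd : nb (scl (2 * d)) (2 * d).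
  by rewrite -{2}(ger0_norm (ltW (mulr_gt0 (ltr0Sn R 1) d0))); exact: nb_scl.
apply: nb_le (nbB (nb_sclM (ltW B0) (nbBC nS)) nd).
rewrite mulrCA divff ?gt_eqF// mulr1 /d; lra.
Qed.

Lemma ui_sum_sqr K J : GRing.comm K J ->
  (K - ui * J) * (K + ui * J) = K * K + J * J.
Proof.
move=> cKJ; rewrite mulrBl !mulrDr.
have -> : K * (ui * J) = ui * J * K by rewrite mulrA -uiC -mulrA cKJ mulrA.
have -> : ui * J * (ui * J) = - (J * J).
  by rewrite mulrA -(mulrA ui J ui) -(uiC J) mulrA ui_sqr mulN1r mulNr.
by rewrite opprD opprK addrA addrK.
Qed.

Lemma half_sum K J : scl 2^-1 * (K + J + (K - J)) = K.
Proof.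
rewrite addrACA subrr addr0 -[K in K + _]mul1r -[K in _ + K]mul1r -mulrDl mulrA.
rewrite -(rmorph1 scl) -(rmorphD scl) -(rmorphM scl) mulVf ?rmorph1 ?mul1r//.
Qed.

(** X = T - L^2 is the real part of Z = X + i s L with s^2 = 2 T, and Z^* Z = X^2 + 2 T L^2 = T^2 +
    L^4. If |L| <= M, this is at most T^2 + M^4 <= (T + e)^2 for T = M^4 / (2 e). *)
Lemma upos_sqr L : sa L -> upos (L * L).
Proof.
move=> sL; split => [|e e0]; first exact: sa_sqr.
have [M M0 LM] := nb_ex L.
have [T T0 MT] : exists2 T, 0 <= T & M * M * (M * M) = 2 * e * T.
  exists (M ^+ 4 / (2 * e)); first by rewrite divr_ge0 ?exprn_ge0// mulr_ge0// ltW.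
  by field; rewrite gt_eqF.
exists T => //; have Te0 : 0 <= T + e by rewrite addr_ge0// ltW.
have [s s2] : exists s, s * s = 2 * T.
  by exists (Num.sqrt (2 * T)); rewrite -expr2 sqr_sqrtr// mulr_ge0.
pose X := scl T - L * L; pose Y := scl s * L; pose Z := X + ui * Y.
have sX : sa X by apply: saB; [exact: sa_scl|exact: sa_sqr].
have sY : sa Y by apply: sa_sclM.
have cXY : GRing.comm X Y.
  apply: commrM; first exact: scl_comm.
  apply/commr_sym/commrB; first exact: scl_comm.
  exact: commrM.
have Zs : star Z = X - ui * Y.
  by rewrite /Z raddfD/= starM star_ui sX sY mulrN uiC.
have ZZ : star Z * Z = X * X + Y * Y.
  by rewrite Zs ui_sum_sqr.
have XY : X * X + Y * Y = scl (T ^+ 2) + L * L * (L * L).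
  have -> : X = ev L (T%:P - 'X * 'X) by rewrite rmorphB rmorphM/= evC evX.
  have -> : Y = ev L (s%:P * 'X) by rewrite rmorphM/= evC evX.
  rewrite -!rmorphM -!rmorphD/=.
  transitivity (ev L ((T^+2)%:P + 'X * 'X * ('X * 'X))); last first.
    by rewrite rmorphD !rmorphM/= evC evX.
  congr (ev L _); rewrite expr2 polyCM.
  transitivity ((T%:P - 'X * 'X) * (T%:P - 'X * 'X) + (s * s)%:P * ('X * 'X)).
    by rewrite polyCM; ring.
  by rewrite s2 polyCM polyC_natr; ring.
have nZ : nb Z (T + e).
  apply: nb_starM => //; rewrite ZZ XY.
  have nL2 := nbM M0 LM LM; have nL4 := nbM (mulr_ge0 M0 M0) nL2 nL2.
  apply: nb_le (nbD (nb_scl _) nL4); rewrite ger0_norm ?sqr_ge0//.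
  by rewrite MT; have := sqr_ge0 e; lra.
rewrite -/X (_ : X = scl 2^-1 * (Z + star Z)); last by rewrite Zs half_sum.
apply: nb_le (nb_sclM _ (nbD nZ (nb_star Te0 nZ))); last by rewrite invr_ge0.
by lra.
Qed.

(** K is the real part of Z = K + i J, and Z^* Z = K^2 + J^2 bounds Z, hence K, by the square root
    of M. *)
Lemma nb_sum_sqr K J M : sa K -> sa J -> GRing.comm K J -> 0 <= M ->
  nb (K * K + J * J) M -> nb (K * K) (M : R).
Proof.
move=> sK sJ cKJ M0 KJM; pose Z := K + ui * J.
have Zs : star Z = K - ui * J.
  by rewrite /Z raddfD/= starM star_ui sK sJ mulrN uiC.
have ZZ : star Z * Z = K * K + J * J.
  by rewrite Zs ui_sum_sqr.
have nZ : nb Z (Num.sqrt M).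
  by apply: nb_starM; rewrite ?sqrtr_ge0// sqr_sqrtr// ZZ.
have nK : nb K (Num.sqrt M).
  have -> : K = scl 2^-1 * (Z + star Z).
    by rewrite Zs half_sum.
  apply: nb_le (nb_sclM _ (nbD nZ (nb_star (sqrtr_ge0 _) nZ))).
    by lra.
  by rewrite invr_ge0.
by have := nbM (sqrtr_ge0 _) nK nK; rewrite -(expr2 (Num.sqrt M)) sqr_sqrtr.
Qed.

(** Replace Q and Q' by squares of commuting self-adjoint elements. The error e / 3 occurs three
    times: twice in the sum of the squares and once in going back to Q. *)
Lemma nb_uposD Q Q' M : upos Q -> upos Q' -> GRing.comm Q Q' -> 0 <= M ->
  nb (Q + Q') M -> nb Q M.
Proof.
move=> pQ pQ' cQ M0 QM; apply: nb_lim => e e0.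
have e30 : 0 < e / 3 by rewrite divr_gt0.
have [S [sS cS nS]] := upos_sqrt pQ e30.
have [S' [sS' cS' nS']] := upos_sqrt pQ' e30.
have cSS : GRing.comm S S'.
  by apply: cS'; apply/commr_sym/cS; exact: commr_sym.
have : nb (S * S) (M + e / 3 + e / 3).
  apply: (nb_sum_sqr sS sS' cSS); first by lra.
  rewrite -(subrK (Q + Q') (S * S + _)) addrC -(addrA M); apply: nbD QM _.
  rewrite opprD addrACA; apply: nbD; exact: nbBC.
move=> /(nbD nS); rewrite subrK; apply: nb_le; lra.
Qed.

(** With S an approximate root of Q that commutes with L, L Q L is close to the self-adjoint square
    (L S)^2. *)
Lemma upos_comm_conj L Q : sa L -> upos Q -> GRing.comm L Q -> upos (L * Q * L).
Proof.
move=> sL pQ cLQ; have [sQ _] := pQ; apply: upos_closed.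
  by rewrite -{1}sL; exact: sa_conj.
move=> e e0; have [M M0 LM] := nb_ex L.
have M10 : 0 < 1 + M * M by rewrite ltr_wpDr// mulr_ge0.
have [S [sS cS nS]] := upos_sqrt pQ (divr_gt0 e0 M10).
exists (L * S * (L * S)).
  by apply: upos_sqr; apply: saM => //; exact: cS.
rewrite (cS _ cLQ) -{1}(cS _ cLQ) !mulrA -(mulrA L S S) -mulrBl -mulrBr.
have e1 : 0 <= e / (1 + M * M) by rewrite divr_ge0 ?ltW.
apply: nb_le (nbM (mulr_ge0 M0 e1) (nbM M0 LM nS) LM).
by rewrite mulrAC mulrA ler_pdivrMr// mulrC ler_wpM2l ?(ltW e0)// lerDr.
Qed.

End Positivity.

(** * Positivity of b^* b *)

Section StarSquares.
Context (R : realType) (A : cstarAlgType R).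
Local Notation U := (unitization A).
Local Notation scl := (@scl R A).
Local Notation ui := (@ui R A).
Implicit Types (b k u v w Q L S K J : U) (a c x y : A) (r s t M T : R).

(** The C*-identity iterated m times; this is why only exponents that are powers of 2 occur. *)
Lemma nb_root u M m : sa u -> 0 <= M -> nb (u ^+ (2 ^ m)) (M ^+ (2 ^ m)) -> nb u M.
Proof.
elim: m u M => [|m IH] u M su M0; first by rewrite !expr1.
rewrite expnS !exprM => uM; apply: nb_starM => //; rewrite su -expr2.
by apply: IH uM; rewrite ?sqr_ge0// expr2; exact: sa_sqr.
Qed.

(* The defect of the powers of t - b^* b from those of t is b^* G b, where G
   is a polynomial in t - b b^*, hence grows as n s^n only. *)
Lemma nb_pow_swap b t s C n : 0 <= t <= s -> 0 < s -> 0 <= C -> nb b C ->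
  nb (scl t - b * star b) s ->
  nb ((scl t - star b * b) ^+ n) (s ^+ n * (1 + n%:R * (C * C / s))).
Proof.
move=> /andP[t0 ts] s0 C0 bC ls.
set k := star b * b; set l := b * star b in ls *.
(* The sum of t^(n - 1 - i) (t - l)^i over i < n, so that l G n = t^n - (t - l)^n. *)
pose G := fix G n := if n is m.+1 then scl t ^+ m + (scl t - l) * G m else 0.
have cnt m : nb (scl t ^+ m) (s ^+ m).
  rewrite -rmorphXn/=; apply: nb_le (nb_scl _).
  by rewrite normrX ger0_norm// lerXn2r// ?nnegrE ltW// (lt_le_trans _ ts).
have nG m : nb (G m) (m%:R * (s ^+ m / s)).
  elim: m => [|m IH] /=; first by rewrite mul0r; exact: nb0.
  apply: nb_le (nbD (cnt m) (nbM (ltW s0) ls IH)).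
  have -> : m.+1%:R * (s ^+ m.+1 / s) = s ^+ m + s * (m%:R * (s ^+ m / s)).
    by rewrite exprS -natr1; field; exact: lt0r_neq0.
  by [].
have -> : (scl t - k) ^+ n = scl t ^+ n - star b * G n * b.
  elim: n => [|n IH]; first by rewrite !expr0 mulr0 mul0r subr0.
  have kb : (scl t - k) * star b = star b * (scl t - l).
    by rewrite mulrBl mulrBr sclC /k /l !mulrA.
  rewrite exprS IH mulrBr.
  have -> : (scl t - k) * (star b * G n * b) =
      star b * ((scl t - l) * G n) * b by rewrite !mulrA kb.
  rewrite mulrBl -exprS [G n.+1]/= mulrDr mulrDl opprD addrA.
  congr (_ - _ - _).
  by rewrite /k -!mulrA -rmorphXn/= sclC.
apply: nb_le (nbB (cnt n) (nbM _ (nbM C0 (nb_star C0 bC) (nG n)) bC)).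
  have -> : s ^+ n * (1 + n%:R * (C * C / s)) =
      s ^+ n + C * (n%:R * (s ^+ n / s)) * C by field; exact: lt0r_neq0.
  by [].
by rewrite !mulr_ge0 ?invr_ge0 ?exprn_ge0// ltW.
Qed.

(** Squaring Bernoulli's inequality gives (1 + x)^(2 j) >= (1 + j x)^2 >= 1 + j^2 x^2, and j^2 x^2
    >= 2 j C as soon as j >= 2 C / x^2. Here j is a power of 2 and 2 j is the exponent. *)
Lemma exp2_beats_linear (x C : R) : 0 < x -> 0 <= C ->
  exists m, 1 + (2 ^ m)%:R * C <= (1 + x) ^+ (2 ^ m).
Proof.
move=> x0 C0; pose m := Num.trunc (2 * C / (x * x)).
exists m.+1; set j := (2 ^ m)%N.
have jm : 2 * C / (x * x) <= j%:R.
  have /ltW/le_trans : 2 * C / (x * x) < m.+1%:R.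
    by rewrite truncnS_gt.
  by apply; rewrite ler_nat ltn_expl.
have j0 : 0 <= j%:R :> R by [].
have jx : 1 + j%:R * x <= (1 + x) ^+ j.
  elim: (j) => [|i IH]; first by rewrite mul0r addr0 expr0.
  rewrite exprS; apply: le_trans (ler_wpM2l _ IH); last by lra.
  rewrite -natr1; have := mulr_ge0 (ler0n R i) (mulr_ge0 (ltW x0) (ltW x0)).
  by nra.
rewrite expnS -/j mulnC exprM; apply: le_trans (_ : (1 + j%:R * x) ^+ 2 <= _).
  rewrite ler_pdivrMr ?mulr_gt0// in jm.
  rewrite natrM; have := ler_wpM2l j0 jm; have := mulr_ge0 j0 (ltW x0).
  by nra.
by rewrite lerXn2r// nnegrE ?addr_ge0 ?mulr_ge0 ?exprn_ge0 ?addr_ge0// ltW.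
Qed.

(** A substitute for the fact that [b b^*] and [b^* b] have the same spectrum up to 0, the point 0
    being covered by t <= s. The linear factor in the bound on powers is absorbed by raising 1 + e /
    s to a large power of 2. *)
Lemma nb_swap b t s : 0 <= t <= s -> 0 < s ->
  nb (scl t - b * star b) s -> nb (scl t - star b * b) s.
Proof.
move=> ts s0 ls; apply: nb_lim => e e0.
have [C C0 bC] := nb_ex b.
have sy : sa (scl t - star b * b).
  by apply: saB; [exact: sa_scl|exact: sa_starM].
have [m mC] := exp2_beats_linear (divr_gt0 e0 s0) (divr_ge0 (mulr_ge0 C0 C0) (ltW s0)).
apply: (nb_root (m := m) sy); first by rewrite addr_ge0 ?ltW.
apply: nb_le (nb_pow_swap _ ts s0 C0 bC ls).
have -> : s + e = s * (1 + e / s) by field; exact: lt0r_neq0.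
by rewrite exprMn ler_wpM2l// exprn_ge0// ltW.
Qed.

Lemma upos_swap b t : 0 <= t ->
  upos (scl t + b * star b) -> upos (scl t + star b * b).
Proof.
move=> t0 [_ pl]; split => [|e e0].
  by apply: saD; [exact: sa_scl|exact: sa_starM].
have [T T0 lT] := pl _ e0; exists (T + t); first exact: addr_ge0.
have e1 u : scl (T + t) - (scl t + u) = scl T - u.
  by rewrite raddfD/= opprD addrA addrK.
rewrite e1; apply: nb_swap; [by lra|by lra|].
rewrite -(e1 (b * star b)) raddfD/= addrAC (addrAC T).
by apply: nbD => //; rewrite -{2}(ger0_norm t0); exact: nb_scl.
Qed.

(** If b = h + i k with h and k self-adjoint, the sum is 2 (h^2 + k^2). *)
Lemma upos_starM_add b : upos (b * star b + star b * b).
Proof.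
have sp : sa (b + star b) by rewrite /sa raddfD/= starK addrC.
have sm : sa (ui * (b - star b)).
  by rewrite /sa starM star_ui raddfB/= starK mulrN -mulNr opprB uiC.
have := uposZ _ (uposD (upos_sqr sp) (upos_sqr sm)).
move=> /(_ 2^-1); rewrite invr_ge0 => /(_ (ler0n _ _)).
congr (upos _).
have -> : ui * (b - star b) * (ui * (b - star b)) =
    - ((b - star b) * (b - star b)).
  by rewrite mulrA -(mulrA ui _ ui) -uiC mulrA ui_sqr mulN1r mulNr.
have -> : (b + star b) * (b + star b) - (b - star b) * (b - star b) =
    (b * star b + star b * b) + (b * star b + star b * b).
  rewrite !mulrDl !mulrDr !(mulrN, mulNr) opprK !opprD !opprK !addrA.
  by rewrite [LHS](ACl (2*3*6*7*1*5*4*8))/= !addrK.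
rewrite mulrDr -mulrDl -(raddfD scl) (_ : 2^-1 + 2^-1 = 1) ?rmorph1 ?mul1r//.
by lra.
Qed.

(** For a real k <= 4 this gives k (3 - k)^2 <= 4: the value 4 is the local maximum, at k = 1,
    whence the double root. *)
Lemma cubic_bound k :
  scl 4 - k * ((scl 3 - k) * (scl 3 - k)) = (k - 1) * (scl 4 - k) * (k - 1).
Proof.
have X1 : (4%:P - 'X * ((3%:P - 'X) * (3%:P - 'X)) : {poly R}) =
    ('X - 1) * (4%:P - 'X) * ('X - 1) by rewrite !polyC_natr; ring.
have := congr1 (ev k) X1.
by rewrite !(rmorphB, rmorphM, rmorph1)/= !evC !evX.
Qed.

(** A lower bound on k (3 - k)^2 yields one on 9 k, since k (6 - k) k is positive for self-adjoint k
    <= 6. *)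
Lemma cubic_split k :
  k * ((scl 3 - k) * (scl 3 - k)) + k * (scl 6 - k) * k = scl 9 * k.
Proof.
have X1 : 'X * ((3%:P - 'X) * (3%:P - 'X)) + 'X * (6%:P - 'X) * 'X =
    9%:P * 'X :> {poly R} by rewrite !polyC_natr; ring.
have := congr1 (ev k) X1.
by rewrite !(rmorphB, rmorphM, rmorphD)/= !evC !evX.
Qed.

(* Shirali-Ford style bootstrapping: if b^* b <= t forces b^* b >= - c t for
   all b, apply this to b (3 - b^* b), after scaling to t = 3, to improve c to
   4 c / 27. *)
Lemma starM_lower_bound n b t : 0 < t -> upos (scl t - star b * b) ->
  upos (scl (2^-1 ^+ n * t) + star b * b).
Proof.
elim: n b t => [|n IH] b t t0 bt.
  (* After exchanging the factors, t + b b^* = (t - b^* b) + (b b^* + b^* b) is a sum of two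
     positive elements. *)
  rewrite expr0 mul1r; apply: upos_swap; first exact: ltW.
  have := uposD bt (upos_starM_add b); congr (upos _).
  by rewrite addrA addrAC addrNK.
pose q := Num.sqrt (3 / t).
have q2 : q * q = 3 / t by rewrite -expr2 sqr_sqrtr// divr_ge0// ltW.
pose d := scl q * b; pose k := star d * d.
have kE : k = scl (3 / t) * (star b * b).
  by rewrite /k /d starM star_scl -sclC mulrA -(mulrA _ (star b)) -sclC !mulrA
    -rmorphM/= q2.
clearbody d; have sk : sa k by exact: sa_starM.
have k3 : upos (scl 3 - k).
  have := uposZ (ltW (divr_gt0 (ltr0Sn R 2) t0)) bt.
  by rewrite mulrBr -kE -rmorphM/= divfK// gt_eqF.
have kle r : 3 <= r -> upos (scl r - k).
  move=> r3; have := uposD k3 (upos_scl A (_ : 0 <= r - 3)).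
  rewrite subr_ge0 => /(_ r3); congr (upos _).
  by rewrite raddfB/= [LHS]addrC addrA subrK.
have s3 : sa (scl 3 - k) by apply: saB => //; exact: sa_scl.
pose d' := d * (scl 3 - k).
have k'E : star d' * d' = k * ((scl 3 - k) * (scl 3 - k)).
  have -> : star d' * d' = (scl 3 - k) * k * (scl 3 - k).
    by rewrite /d' starM s3 /k !mulrA.
  rewrite [RHS]mulrA; congr (_ * _).
  by rewrite mulrBl mulrBr sclC.
have k'4 : upos (scl 4 - star d' * d').
  rewrite k'E cubic_bound.
  apply: upos_comm_conj.
  - by apply: saB => //; rewrite -(rmorph1 scl); exact: sa_scl.
  - by apply: kle; lra.
  - by apply/commr_sym/commrB;
      [apply/commr_sym/commrB => //; exact: scl_comm|exact: commr1].
have H9 : upos (scl (2^-1 ^+ n * 4) + scl 9 * k).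
  have := uposD (IH _ _ (ltr0Sn R 3) k'4) (upos_comm_conj sk (kle 6 _) _).
  rewrite -addrA k'E cubic_split.
  apply; first by lra.
  by apply: commrB => //; exact: scl_comm.
have t27 : 0 <= t / 27 by rewrite divr_ge0// ltW.
have := uposZ t27 H9.
rewrite mulrDr kE !mulrA -!rmorphM/= (_ : t / 27 * 9 * (3 / t) = 1); last first.
  by field; exact: lt0r_neq0.
rewrite rmorph1 mul1r => Hk.
have p2 : 0 <= 2^-1 ^+ n :> R by rewrite exprn_ge0.
(* The gain 4 / 27 is weakened to 1 / 2, which suffices for convergence to 0. *)
have c0 : 0 <= 2^-1 ^+ n.+1 * t - t / 27 * (2^-1 ^+ n * 4).
  have := mulr_ge0 p2 (ltW t0); rewrite exprS; lra.
by have := uposD (upos_scl A c0) Hk; rewrite addrA -raddfD/= subrK.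
Qed.

(** The lower bounds -2^(-n) t tend to 0 and the cone is closed. The bound t is taken as M + 1 to be
    nonzero. *)
Theorem upos_starM b : upos (star b * b).
Proof.
apply: upos_closed => [|e e0]; first exact: sa_starM.
have [M M0 bM] := nb_ex (star b * b).
have M1 : 0 < M + 1 by lra.
have bt : upos (scl (M + 1) - star b * b).
  apply: upos_nb; [exact: ltW|exact: sa_starM|apply: nb_le bM; lra].
have [n nlt] : exists n, 2^-1 ^+ n < e / (M + 1).
  have r1 : `|2^-1 : R| < 1 by rewrite ger0_norm; lra.
  have /cvgrPdist_lt/(_ _ (divr_gt0 e0 M1))[n _ /(_ n (leqnn _))] := cvg_expr r1.
  by rewrite sub0r normrN ger0_norm ?exprn_ge0// => ?; exists n.
exists (scl (2^-1 ^+ n * (M + 1)) + star b * b).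
  exact: starM_lower_bound.
have r0 : 0 <= 2^-1 ^+ n * (M + 1) by rewrite mulr_ge0 ?exprn_ge0// ltW.
rewrite opprD addrCA subrr addr0; apply/nbN.
apply: nb_le (nb_scl _); rewrite ger0_norm//.
by rewrite -ler_pdivlMr// ltW.
Qed.

Definition apos a := upos (emb a).

Lemma apos_starM a : apos (cmul (cstar a) a).
Proof. by rewrite /apos embM -star_emb; exact: upos_starM. Qed.

Lemma aposD a c : apos a -> apos c -> apos (a + c).
Proof. by move=> pa pc; rewrite /apos raddfD; exact: uposD. Qed.

Lemma aposZ r a : 0 <= r -> apos a -> apos (r%:C *: a).
Proof. by move=> r0 pa; rewrite /apos embZ; exact: uposZ. Qed.

Lemma apos_sa a : apos a -> cstar a = a.
Proof. by case=> -[]. Qed.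

Lemma apos_closed a :
  (forall e, 0 < e -> exists2 c, apos c & normR (a - c) <= e) -> apos a.
Proof.
move=> H; apply: upos_closed.
  rewrite /sa star_emb; congr emb; apply/eqP; rewrite -subr_eq0; apply/eqP.
  apply: normR_eq0; apply/eqP; rewrite eq_le normR_ge0 andbT.
  apply/ler_addgt0Pr => e e0; rewrite add0r.
  have [c pc ac] := H _ (divr_gt0 e0 (ltr0Sn _ 1)).
  rewrite -(subrKA c) (le_trans (normRD _ _))// [e]splitr lerD//.
    by rewrite -{1}(apos_sa pc) -cstarN -cstarD normR_star.
  by rewrite normR_distC.
move=> e e0; have [c pc ac] := H _ e0; exists (emb c) => //.
by rewrite -raddfB; apply: nb_le (@nb_emb _ _ _).
Qed.

(** With M = |a + c|, M - a = (M - (a + c)) + c is positive. It commutes with a even if c does not,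
    and the two add up to the scalar M. *)
Lemma normR_aposD a c : apos a -> apos c -> normR a <= normR (a + c).
Proof.
move=> pa pc; apply: normR_emb (normR_ge0 _) _.
have M0 := normR_ge0 (a + c).
have sac : sa (emb (a + c)) by have [] := aposD pa pc.
have H : upos (scl (normR (a + c)) - emb a).
  have := uposD (upos_nb M0 sac (@nb_emb _ _ _)) pc.
  by rewrite raddfD/= opprD addrA subrK.
apply: (nb_uposD pa H) => //.
  apply: commrB => //; exact: scl_comm.
by rewrite addrC subrK -{2}(ger0_norm M0); exact: nb_scl.
Qed.

(** If S is an approximate root of M - c, then a^* (M - c) a is close to [(S a)^* (S a)], which is
    positive although a and S need not commute. *)
Lemma apos_conj_le a c M : cstar c = c -> normR c <= M -> 0 <= M ->
  apos (M%:C *: cmul (cstar a) a - cmul (cstar a) (cmul c a)).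
Proof.
move=> sc cM M0.
have pQ : upos (scl M - emb c).
  apply: upos_nb => //; first by rewrite /sa star_emb sc.
  by apply: nb_le (@nb_emb _ _ _).
have e1 : emb (M%:C *: cmul (cstar a) a - cmul (cstar a) (cmul c a)) =
    star (emb a) * (scl M - emb c) * emb a.
  by rewrite raddfB/= embZ !embM star_emb mulrBr mulrBl -(sclC M (emb (cstar a))) -!mulrA.
rewrite /apos e1; apply: upos_closed; first by apply: sa_conj; case: pQ.
move=> e e0; set N := normR a.
have N1 : 0 < 1 + N * N by rewrite ltr_wpDr// mulr_ge0// normR_ge0.
have [S [sS _ nS]] := upos_sqrt pQ (divr_gt0 e0 N1).
exists (star (S * emb a) * (S * emb a)); first exact: upos_starM.
have -> : star (S * emb a) * (S * emb a) = star (emb a) * (S * S) * emb a.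
  by rewrite starM sS !mulrA.
rewrite -mulrBl -mulrBr.
have N0 : 0 <= N by exact: normR_ge0.
have e2 : 0 <= e / (1 + N * N) by rewrite divr_ge0 ?ltW.
apply: nb_le (nbM (mulr_ge0 N0 e2) (nbM N0 (nb_star N0 (@nb_emb _ _ _)) nS)
  (@nb_emb _ _ _)).
by rewrite mulrAC mulrA ler_pdivrMr// mulrC ler_wpM2l ?(ltW e0)// lerDr.
Qed.

End StarSquares.

(** * Bochner integral *)

Section Convergence.
Context (R : realType) (E : normedModType R[i]).

Lemma cvg_normRP (u : nat -> E) (l : E) :
  u n @[n --> \oo] --> l <-> normR (u n - l) @[n --> \oo] --> (0 : R).
Proof.
split.
  move=> /cvgrPdist_lt H; apply/cvgrPdist_lt => e e0.
  have e0' : 0 < e%:C by rewrite ltcR.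
  have := H _ e0'; apply: filterS => n.
  by rewrite sub0r normrN ger0_norm ?normR_ge0// -ltcR normRE distrC.
move=> /cvgrPdist_lt H; apply/cvgrPdist_lt => e e0.
have eE : e = (complex.Re e)%:C by rewrite RRe_real// gtr0_real.
have e0' : 0 < complex.Re e by rewrite -ltcR -eE.
have := H _ e0'; apply: filterS => n.
by rewrite sub0r normrN ger0_norm ?normR_ge0// eE -ltcR normRE distrC.
Qed.

Lemma normR_cvg (u : nat -> E) (l : E) :
  u n @[n --> \oo] --> l -> normR (u n) @[n --> \oo] --> normR l.
Proof.
move=> /cvg_normRP ul; apply/cvgrPdist_le => e e0.
move/cvgrPdist_le : ul => /(_ _ e0); apply: filterS => n.
rewrite sub0r normrN ger0_norm ?normR_ge0// => ne.
by rewrite (le_trans _ ne)// distrC ler_normRB.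
Qed.

Lemma cvg_normR_le (u : nat -> E) (l : E) (a : nat -> R) :
  a n @[n --> \oo] --> (0 : R) -> (forall n, normR (u n - l) <= a n) ->
  u n @[n --> \oo] --> l.
Proof.
move=> a0 ua; apply/cvg_normRP; apply: (@squeeze_cvgr _ _ _ _ (fun=> 0) a) => //.
  by apply: nearW => n; rewrite normR_ge0 ua.
exact: cvg_cst.
Qed.

End Convergence.

Section LowerIntegral.
Context (R : realType) d (T : measurableType d) (P : probability T R).

(* The library integral of a nonnegative function is a lower integral, which
   is monotone and ignores null sets without any measurability. *)
Import HBNNSimple.

Lemma ae_le_integralR (f g : T -> R) :
  (forall t, 0 <= f t) -> (forall t, 0 <= g t) -> {ae P, forall t, f t <= g t} ->
  (\int[P]_t (f t)%:E <= \int[P]_t (g t)%:E)%E.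
Proof.
move=> f0 g0 [N [mN N0 fgN]].
rewrite !ge0_integralTE; [|by move=> t; rewrite lee_fin..].
apply: ge_ereal_sup => _ [h /= hf <-].
(* A simple minorant h of f, set to 0 on the null set N, is a minorant of g with the same
   integral. *)
apply: le_trans (ereal_sup_ubound _); last first.
  exists (proj_nnsfun h (measurableC mN)) => //= t.
  rewrite lee_fin /mindic indicE.
  have [tN|tN] := boolP (t \in ~` N); last by rewrite mulr0.
  rewrite mulr1; have := hf t; rewrite lee_fin => /le_trans; apply.
  by move: tN; rewrite inE => tN; apply: contrapT => fg; apply: tN; apply: fgN.
rewrite -!integralT_nnsfun le_eqVlt; apply/orP; left; apply/eqP.
apply: ge0_ae_eq_integral => //.
- by apply/measurable_EFinP; exact: measurable_funP.
- by apply/measurable_EFinP; exact: measurable_funP.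
- by move=> t _; rewrite lee_fin.
- by move=> t _; rewrite lee_fin.
exists N; split => // t /=; apply: contra_notP => tN _.
by rewrite /mindic indicE mem_set ?mulr1.
Qed.

Lemma ge0_le_integralR (f g : T -> R) :
  (forall t, 0 <= f t) -> (forall t, f t <= g t) ->
  (\int[P]_t (f t)%:E <= \int[P]_t (g t)%:E)%E.
Proof.
move=> f0 fg; apply: ae_le_integralR => // [t|].
  exact: le_trans (fg t).
exact: aeW.
Qed.

End LowerIntegral.

(** * Simple functions and their integrals *)

Section SimpleFun.
Context (R : realType) d (T : measurableType d) (P : probability T R).

Lemma simple_preimage (F : Type) (s : T -> F) (B : set F) :
  simple_fun s -> measurable (s @^-1` B).
Proof.
move=> [fs ms].
have -> : s @^-1` B = \bigcup_(v in range s `&` B) s @^-1` [set v].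
  apply/seteqP; split => [t Bt|t [v [_ Bv] /= stv]].
    by exists (s t) => //; split => //; exists t.
  by rewrite /= stv.
apply: fin_bigcup_measurable => [|v _]; last exact: ms.
exact: finite_setIl.
Qed.

Lemma simple_comp (F G : Type) (s : T -> F) (phi : F -> G) :
  simple_fun s -> simple_fun (phi \o s).
Proof.
move=> ss; have [fs _] := ss; split => [|v].
  have -> : range (phi \o s) = phi @` range s by rewrite image_comp.
  exact: finite_image.
by rewrite comp_preimage; exact: simple_preimage.
Qed.

Lemma simple_pair (F G : Type) (s : T -> F) (r : T -> G) :
  simple_fun s -> simple_fun r -> simple_fun (fun t => (s t, r t)).
Proof.
move=> [fs ms] [fr mr]; split.
  apply: sub_finite_set (finite_setX fs fr) => _ [t _ <-] /=.
  by split; exists t.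
move=> [v w].
have -> : (fun t => (s t, r t)) @^-1` [set (v, w)] =
    s @^-1` [set v] `&` r @^-1` [set w].
  by apply/seteqP; split => t /= [-> ->].
exact: measurableI.
Qed.

Lemma simple_comp2 (F G H : Type) (s : T -> F) (r : T -> G) (phi : F -> G -> H) :
  simple_fun s -> simple_fun r -> simple_fun (fun t => phi (s t) (r t)).
Proof.
move=> ss sr; exact: (simple_comp (fun p => phi p.1 p.2) (simple_pair ss sr)).
Qed.

Lemma simple_cst (F : Type) (v : F) : simple_fun (fun=> v : F) (T := T).
Proof.
split; first by apply: sub_finite_set (finite_set1 v) => _ [t _ <-].
move=> w; have [->|vw] := pselect (v = w).
  by rewrite (_ : _ @^-1` _ = setT)//; apply/seteqP; split.
by rewrite (_ : _ @^-1` _ = set0)//; apply/seteqP; split.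
Qed.

Lemma simple_mem (B : set T) : measurable B -> simple_fun (fun t => t \in B).
Proof.
move=> mB; split; first exact: finite_finset.
case.
  rewrite (_ : _ @^-1` _ = B)//.
  by apply/seteqP; split => t /=; [move=> /set_mem|move=> /mem_set].
rewrite (_ : _ @^-1` _ = ~` B); first exact: measurableC.
apply/seteqP; split => t /=; last by move=> Bt; apply/negbTE; rewrite notin_setE.
by move=> /negbT; rewrite notin_setE.
Qed.

Lemma simple_measurable (s : T -> R) : simple_fun s -> measurable_fun setT s.
Proof. by move=> ss _ B mB; rewrite setTI; exact: simple_preimage. Qed.

Definition pr (F : Type) (s : T -> F) (v : F) : R := fine (P (s @^-1` [set v])).

Lemma pr_ge0 (F : Type) (s : T -> F) v : 0 <= pr s v.
Proof. by rewrite /pr fine_ge0. Qed.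

Lemma pr_comp (F G : choiceType) (s : T -> F) (phi : F -> G) v : simple_fun s ->
  pr (phi \o s) v = \sum_(w <- fset_set (range s) | phi w == v) pr s w.
Proof.
move=> [fs ms]; rewrite /pr.
have -> : (phi \o s) @^-1` [set v] =
    \bigcup_(w in range s `&` phi @^-1` [set v]) s @^-1` [set w].
  apply/seteqP; split => [t <-|t [w [_ /= <-] <-]//].
  by exists (s t) => //; split => //; exists t.
rewrite measure_fin_bigcup//; last 2 first.
- exact: finite_setIl.
- by move=> w w' _ _ [t [/= <- <-]].
rewrite fsbig_mkcondr fsbig_finite// big_mkcond/= [in RHS]big_mkcond/=.
transitivity (fine (\sum_(w <- fset_set (range s))
    (if phi w == v then pr s w else 0)%:E)%E); last by rewrite sumEFin.
rewrite /pr; congr fine; apply: eq_bigr => w _.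
have -> : (w \in phi @^-1` [set v]) = (phi w == v).
  by apply/idP/eqP; rewrite inE.
by case: ifP => // _; rewrite fineK// fin_num_measure.
Qed.

Section Integral.
Context (E : normedModType R[i]).

Lemma simple_integralE (s : T -> E) : simple_fun s ->
  simple_integral P s = \sum_(v <- fset_set (range s)) (pr s v)%:C *: v.
Proof. by move=> [fs _]; rewrite /simple_integral fsbig_finite. Qed.

(** Change of variables to the law of s. Applied to a pair of simple functions, it writes their
    integrals and that of their sum over one common index set. *)
Lemma simple_integral_comp (F : choiceType) (s : T -> F) (phi : F -> E) :
  simple_fun s ->
  simple_integral P (phi \o s) =
    \sum_(w <- fset_set (range s)) (pr s w)%:C *: phi w.
Proof.
move=> ss; have [fs _] := ss; rewrite simple_integralE; last exact: simple_comp.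
under eq_bigr do rewrite pr_comp// rmorph_sum/= scaler_suml.
under eq_bigr do rewrite big_mkcond/=.
rewrite exchange_big/=; apply: eq_big_seq => w ws.
have ws' : range s w by move: ws; rewrite in_fset_set// inE.
rewrite -big_mkcond/=.
under eq_bigl do rewrite eq_sym.
rewrite -big_filter filter_pred1_uniq ?fset_uniq ?big_seq1// in_fset_set.
  by rewrite inE; case: ws' => t _ <-; exists t.
by have [] := simple_comp phi ss.
Qed.

Lemma simple_integralD (s r : T -> E) : simple_fun s -> simple_fun r ->
  simple_integral P (fun t => s t + r t) =
  simple_integral P s + simple_integral P r.
Proof.
move=> ss sr; have sp := simple_pair ss sr.
rewrite (simple_integral_comp (fun p => p.1 + p.2) sp).
have -> : s = fst \o (fun t => (s t, r t)) by [].
have e2 : r = snd \o (fun t => (s t, r t)) by [].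
rewrite [in simple_integral P r]e2 !simple_integral_comp// -big_split/=.
by apply: eq_bigr => p _; rewrite scalerDr.
Qed.

Lemma simple_integral_cst (v : E) : simple_integral P (fun=> v) = v.
Proof.
have -> : (fun=> v) = (fun=> v) \o (fun _ : T => tt) by [].
rewrite simple_integral_comp; last exact: simple_cst.
have -> : range (fun _ : T => tt) = [set tt].
  by apply/seteqP; split => [[]//|[] _]; exists point.
rewrite fset_set1 big_seq_fset1 /pr (_ : _ @^-1` _ = setT); last first.
  by apply/seteqP; split.
by rewrite probability_setT scale1r.
Qed.

Lemma simple_integral_norm (s : T -> E) : simple_fun s ->
  ((normR (simple_integral P s))%:E <= \int[P]_t (normR (s t))%:E)%E.
Proof.
move=> ss; have [fs ms] := ss; rewrite simple_integralE//.
have -> : (\int[P]_t (normR (s t))%:E =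
    \sum_(v <- fset_set (range s)) (pr s v * normR v)%:E)%E.
  transitivity (\int[P]_t
      (\sum_(v <- fset_set (range s)) (normR v * \1_(s @^-1` [set v]) t)%:E))%E.
    apply: eq_integral => t _; rewrite sumEFin; congr EFin.
    rewrite (bigD1_seq (s t)) ?fset_uniq//=; last first.
      by rewrite in_fset_set// inE; exists t.
    rewrite indicE mem_set//= mulr1 big1 ?addr0// => v vt.
    rewrite indicE memNset ?mulr0//= => /esym/eqP.
    exact/negP.
  rewrite ge0_integral_sum//; first last.
  - by move=> v t _; rewrite lee_fin mulr_ge0 ?normR_ge0.
  - move=> v; apply/measurable_EFinP.
    exact: (measurable_funM (measurable_cst _) (measurable_indic (ms v))).
  apply: eq_bigr => v _; under eq_integral do rewrite EFinM.
  rewrite ge0_integralZl//; last 2 first.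
  - by apply/measurable_EFinP; apply: measurable_indic; exact: ms.
  - by rewrite lee_fin normR_ge0.
  by rewrite integral_indic// setIT /pr EFinM fineK ?fin_num_measure// muleC.
rewrite sumEFin lee_fin; apply: (@big_ind2 _ _ (fun x y => normR x <= y)).
- by rewrite normR0.
- by move=> *; rewrite (le_trans (normRD _ _))// lerD.
- by move=> v _; rewrite normRZ ger0_norm// pr_ge0.
Qed.

End Integral.

Lemma simple_integral_linear (E F : normedModType R[i]) (s : T -> E)
    (phi : E -> F) :
  {morph phi : x y / x + y} -> (forall r x, phi (r%:C *: x) = r%:C *: phi x) ->
  simple_fun s -> simple_integral P (phi \o s) = phi (simple_integral P s).
Proof.
move=> phiD phiZ ss; rewrite simple_integral_comp// simple_integralE//.
have phi0 : phi 0 = 0 by rewrite -[X in phi X](scale0r (0 : E)) (phiZ 0) scale0r.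
rewrite (big_morph phi phiD phi0).
by apply: eq_bigr => v _; rewrite phiZ.
Qed.

End SimpleFun.

(** * Existence, uniqueness and linearity of the Bochner integral *)

Section Bochner.
Context (R : realType) d (T : measurableType d) (P : probability T R).

(** Limits at every point make the norm of f measurable, as dominated convergence requires. Strongly
    measurable functions are replaced by such representatives, equal to them almost everywhere. *)
Definition slim (E : normedModType R[i]) (f : T -> E) :=
  exists s : nat -> T -> E, (forall n, simple_fun (s n)) /\
    forall t, s n t @[n --> \oo] --> f t.

Lemma slim_strongly_measurable (E : normedModType R[i]) (f : T -> E) :
  slim f -> strongly_measurable P f.
Proof. by move=> [s [ss sf]]; exists s; split => //; exact: aeW. Qed.

Lemma strongly_measurable_slim (E : normedModType R[i]) (f : T -> E) :
  strongly_measurable P f ->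
  exists2 g, slim g & {ae P, forall t, f t = g t}.
Proof.
move=> [s [ss [N [mN N0 sN]]]].
pose cut (v : E) (b : bool) := if b then 0 else v.
exists (fun t => cut (f t) (t \in N)).
  exists (fun n t => cut (s n t) (t \in N)); split.
    by move=> n; apply: simple_comp2 (ss n) (simple_mem mN).
  move=> t; case: (boolP (t \in N)) => [_|tN]; first exact: cvg_cst.
  by apply: contrapT => /sN; move: tN; rewrite notin_setE.
exists N; split => // t /= ft; apply: contrapT => tN; apply: ft.
by rewrite memNset.
Qed.

Lemma slim_cst (E : normedModType R[i]) (v : E) : slim (fun=> v).
Proof.
exists (fun n _ => v); split => [n|t]; first exact: simple_cst.
exact: cvg_cst.
Qed.

Lemma slim_comp2 (E F G : normedModType R[i]) (phi : E -> F -> G) f g :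
  (forall (u : nat -> E) (v : nat -> F) x y, u n @[n --> \oo] --> x ->
     v n @[n --> \oo] --> y -> phi (u n) (v n) @[n --> \oo] --> phi x y) ->
  slim f -> slim g -> slim (fun t => phi (f t) (g t)).
Proof.
move=> cphi [s [ss sf]] [r [sr rg]].
exists (fun n t => phi (s n t) (r n t)); split => [n|t].
  exact: simple_comp2.
by apply: cphi.
Qed.

Lemma slimD (E : normedModType R[i]) (f g : T -> E) :
  slim f -> slim g -> slim (fun t => f t + g t).
Proof. by apply: (slim_comp2 (phi := fun x y => x + y)) => u v x y; exact: cvgD. Qed.

Lemma slimB (E : normedModType R[i]) (f g : T -> E) :
  slim f -> slim g -> slim (fun t => f t - g t).
Proof. by apply: (slim_comp2 (phi := fun x y => x - y)) => u v x y; exact: cvgB. Qed.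

Lemma slim_measurable (E : normedModType R[i]) (f : T -> E) :
  slim f -> measurable_fun setT (fun t => normR (f t)).
Proof.
move=> [s [ss sf]]; apply: (@measurable_fun_cvg _ _ _ _ (fun n t => normR (s n t))).
  by move=> n; apply: simple_measurable; exact: (simple_comp (@normR R E)).
by move=> t _; exact: normR_cvg.
Qed.

Lemma slim_measurableE (E : normedModType R[i]) (f : T -> E) :
  slim f -> measurable_fun setT (fun t => (normR (f t))%:E).
Proof. by move=> sf; apply/measurable_EFinP; exact: slim_measurable. Qed.

Lemma slim_simple (E : normedModType R[i]) (s : T -> E) : simple_fun s -> slim s.
Proof. by move=> ss; exists (fun=> s); split => // t; exact: cvg_cst. Qed.

(** Replace s n by 0 wherever |s n| > 2 |f|. There |s n - f| > |f|, so the truncation does not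
    increase the error, and the new sequence is dominated. *)
Lemma slim_approx (E : normedModType R[i]) (f : T -> E) : slim f ->
  exists s : nat -> T -> E, [/\ forall n, simple_fun (s n),
    forall t, s n t @[n --> \oo] --> f t &
    forall n t, normR (s n t) <= 2 * normR (f t)].
Proof.
move=> sf; have [s [ss cs]] := sf.
pose B n := [set t | normR (s n t) <= 2 * normR (f t)].
have mB n : measurable (B n).
  rewrite -[B n]setTI; apply: measurable_fun_le => //.
    by apply: slim_measurable; exact: slim_simple.
  by apply: measurable_funM => //; exact: slim_measurable.
pose cut (v : E) (b : bool) := if b then v else 0.
have le n t : normR (cut (s n t) (t \in B n) - f t) <= normR (s n t - f t).
  rewrite /cut; case: ifPn => //; rewrite notin_setE /B /= => /negP.
  rewrite -ltNge sub0r normRN => sft.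
  by have := normRD (s n t - f t) (f t); rewrite subrK; lra.
exists (fun n t => cut (s n t) (t \in B n)); split.
- by move=> n; apply: simple_comp2 (ss n) (simple_mem (mB n)).
- move=> t; apply: (@cvg_normR_le _ _ _ _ (fun n => normR (s n t - f t))) => //.
  exact/cvg_normRP.
- move=> n t; rewrite /cut; case: ifPn; first by rewrite inE.
  by move=> _; rewrite normR0 mulr_ge0// normR_ge0.
Qed.

Lemma dominated_normR (E : normedModType R[i]) (f : T -> E) s (G : T -> R) :
  slim f -> (forall n, simple_fun (s n)) ->
  (forall t, s n t @[n --> \oo] --> f t) -> measurable_fun setT G ->
  (forall n t, normR (f t - s n t) <= G t) -> (\int[P]_t (G t)%:E < +oo)%E ->
  (\int[P]_t (normR (f t - s n t))%:E)%E @[n --> \oo] --> 0%E.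
Proof.
move=> sf ss cs mG fsG iG.
have G0 t : 0 <= G t := le_trans (normR_ge0 _) (fsG 0%N t).
have -> : 0%E = (\int[P]_t (cst 0%E t))%E by rewrite integral0.
apply: (@dominated_cvg _ _ _ P setT measurableT
  (fun n t => (normR (f t - s n t))%:E) (cst 0%E) (EFin \o G)) => //.
- move=> n; apply: slim_measurableE; apply: slimB => //; exact: slim_simple.
- move=> t _; apply: cvg_EFin; first exact: nearW.
  under eq_fun do rewrite normR_distC.
  exact/cvg_normRP.
- apply/integrableP; split; first exact/measurable_EFinP.
  by under eq_integral do rewrite /= ger0_norm//.
- by move=> n t _ /=; rewrite lee_fin ger0_norm ?normR_ge0.
Qed.

Lemma simple_integral_dist (E : normedModType R[i]) (f s r : T -> E) :
  slim f -> simple_fun s -> simple_fun r ->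
  ((normR (simple_integral P s - simple_integral P r))%:E <=
    \int[P]_t (normR (f t - s t))%:E + \int[P]_t (normR (f t - r t))%:E)%E.
Proof.
move=> sf ss sr.
have -> : simple_integral P s - simple_integral P r =
    simple_integral P (fun t => s t - r t).
  rewrite (simple_integralD _ ss (simple_comp -%R sr)); congr (_ + _).
  rewrite (simple_integral_linear P (phi := -%R))//.
    by move=> x y; rewrite opprD.
  by move=> a x; rewrite scalerN.
apply: le_trans (simple_integral_norm _ (simple_comp2 (fun x y => x - y) ss sr)) _.
have mf (r' : T -> E) : simple_fun r' -> measurable_fun setT
    (fun t => (normR (f t - r' t))%:E).
  by move=> sr'; apply: slim_measurableE; apply: slimB => //; exact: slim_simple.
rewrite -ge0_integralD//; last 4 first.
- by move=> t _; rewrite lee_fin normR_ge0.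
- exact: mf.
- by move=> t _; rewrite lee_fin normR_ge0.
- exact: mf.
under [leRHS]eq_integral do rewrite -EFinD.
apply: ge0_le_integralR => t; first exact: normR_ge0.
rewrite -(subrKA (f t)) (le_trans (normRD _ _))// normR_distC.
by rewrite (normR_distC (f t)).
Qed.

Lemma cvge0_near (a : nat -> \bar R) e : a n @[n --> \oo] --> 0%E -> 0 < e ->
  \forall n \near \oo, (a n <= e%:E)%E.
Proof.
move=> /fine_cvgP[fa a0] e0; move/cvgrPdist_le : a0 => /(_ _ e0).
apply: filterS2 fa => n fn; rewrite sub0r normrN => /(le_trans (ler_norm _)).
by rewrite -lee_fin /= fineK.
Qed.

Lemma bochner_unique (E : normedModType R[i]) (f : T -> E) v w : slim f ->
  is_bochner_integral P f v -> is_bochner_integral P f w -> v = w.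
Proof.
move=> sf [_ [s [ss is_ sv]]] [_ [r [sr ir rw_]]].
have h : (simple_integral P (s n) - simple_integral P (r n)) @[n --> \oo] --> v - w.
  exact: cvgB.
have h' : (simple_integral P (s n) - simple_integral P (r n)) @[n --> \oo] --> (0 : E).
  apply/cvg_normRP/cvgrPdist_le => e e0; have e20 : 0 < e / 2 by rewrite divr_gt0.
  apply: filterS2 (cvge0_near is_ e20) (cvge0_near ir e20) => n sn rn.
  rewrite subr0 sub0r normrN ger0_norm ?normR_ge0// -lee_fin [e]splitr EFinD.
  exact: le_trans (simple_integral_dist sf (ss n) (sr n)) (leeD sn rn).
by apply/eqP; rewrite -subr_eq0; apply/eqP; exact: cvg_unique h h'.
Qed.

Lemma bochnerE (E : normedModType R[i]) (f : T -> E) v : slim f ->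
  is_bochner_integral P f v -> bochner P f = v.
Proof.
move=> sf fv; rewrite /bochner; case: xgetP => [w _ fw|/(_ v)//].
exact: bochner_unique fw fv.
Qed.

(** The same approximating sequence serves g: lower integrals of functions equal almost everywhere
    coincide without measurability. *)
Lemma is_bochner_ae (E : normedModType R[i]) (f g : T -> E) v :
  {ae P, forall t, f t = g t} ->
  is_bochner_integral P f v -> is_bochner_integral P g v.
Proof.
move=> fg [[s [ss sf]] [r [sr ir rv]]]; split.
  exists s; split => //; apply: filterS2 fg sf => t ->; exact.
exists r; split => //.
rewrite (_ : (fun n => _) = (fun n => \int[P]_t (normR (f t - r n t))%:E)%E)//.
apply/funext => n; apply/eqP; rewrite eq_le; apply/andP; split.
  apply: ae_le_integralR => [t|t|]; [exact: normR_ge0|exact: normR_ge0|].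
  by apply: filterS fg => t ->.
apply: ae_le_integralR => [t|t|]; [exact: normR_ge0|exact: normR_ge0|].
by apply: filterS fg => t ->.
Qed.

Lemma bochner_ae (E : normedModType R[i]) (f g : T -> E) :
  {ae P, forall t, f t = g t} -> bochner P f = bochner P g.
Proof.
move=> fg; rewrite /bochner; congr xget; apply/seteqP.
split => v; apply: is_bochner_ae => //.
by apply: filterS fg => t ->.
Qed.

Definition L1 (E : normedModType R[i]) (f : T -> E) :=
  slim f /\ (\int[P]_t (normR (f t))%:E < +oo)%E.

(** Dominated approximations, with |f - s n| <= 3 |f|, converge to f in mean, so their integrals
    form a Cauchy sequence. *)
Lemma L1_bochner (E : completeNormedModType R[i]) (f : T -> E) :
  L1 f -> is_bochner_integral P f (bochner P f).
Proof.
move=> [sf fi]; suff [v fv] : exists v, is_bochner_integral P f v.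
  by rewrite (bochnerE sf fv).
have [s [ss cs sb]] := slim_approx sf.
have is0 : (\int[P]_t (normR (f t - s n t))%:E)%E @[n --> \oo] --> 0%E.
  apply: (@dominated_normR _ _ _ (fun t => 3 * normR (f t))) => //.
  - by apply: measurable_funM => //; exact: slim_measurable.
  - by move=> n t; have := normRB (f t) (s n t); have := sb n t; lra.
  - under eq_integral do rewrite EFinM.
    rewrite ge0_integralZl//.
    - by rewrite lte_mul_pinfty.
    - exact: slim_measurableE.
    - by move=> t _; rewrite lee_fin normR_ge0.
suff : cvg (simple_integral P (s n) @[n --> \oo]).
  move=> /cvg_ex[v sv]; exists v; split; first exact: slim_strongly_measurable.
  by exists s.
apply: cauchy_cvg; apply: cauchy_exP => e e0.
have eE : e = (complex.Re e)%:C by rewrite RRe_real// gtr0_real.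
have e20 : 0 < complex.Re e / 3 by rewrite divr_gt0// -ltcR -eE.
have [N _ HN] := cvge0_near is0 e20.
exists (simple_integral P (s N)); exists N => //= n Nn.
rewrite -ball_normE /= eE -normRE ltcR -lte_fin.
apply: le_lt_trans (simple_integral_dist sf (ss N) (ss n)) _.
apply: le_lt_trans (leeD (HN N (leqnn _)) (HN n Nn)) _.
by rewrite -EFinD lte_fin; lra.
Qed.

Lemma slim_linear (E F : normedModType R[i]) (f : T -> E) (phi : E -> F) M :
  {morph phi : x y / x - y} -> (forall x, normR (phi x) <= M * normR x) ->
  slim f -> slim (phi \o f).
Proof.
move=> phiB phiM [s [ss cs]]; exists (fun n => phi \o s n); split => [n|t].
  exact: simple_comp.
apply: (@cvg_normR_le _ _ _ _ (fun n => M * normR (s n t - f t))).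
  by rewrite -[X in _ --> X](mulr0 M); apply: cvgMr; exact/cvg_normRP.
by move=> n /=; rewrite -phiB.
Qed.

Lemma integral_normR_le (E F : normedModType R[i]) (f : T -> E) (g : T -> F) M :
  slim f -> 0 <= M -> (forall t, normR (g t) <= M * normR (f t)) ->
  (\int[P]_t (normR (g t))%:E <= M%:E * \int[P]_t (normR (f t))%:E)%E.
Proof.
move=> sf M0 gf; rewrite -ge0_integralZl//; last 2 first.
- exact: slim_measurableE.
- by move=> t _; rewrite lee_fin normR_ge0.
under [leRHS]eq_integral do rewrite -EFinM.
by apply: ge0_le_integralR => t //; exact: normR_ge0.
Qed.

Lemma L1_le (E F : normedModType R[i]) (f : T -> E) (g : T -> F) M :
  L1 f -> slim g -> 0 <= M -> (forall t, normR (g t) <= M * normR (f t)) -> L1 g.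
Proof.
move=> [sf fi] sg M0 gf; split => //.
by apply: le_lt_trans (integral_normR_le sf M0 gf) _; rewrite lte_mul_pinfty.
Qed.

Lemma L1_cst (E : normedModType R[i]) (v : E) : L1 (fun=> v).
Proof.
split; first exact: slim_cst.
rewrite integral_cst// [X in (_ * X)%E]probability_setT mule1; exact: ltry.
Qed.

Lemma bochner_cst (E : normedModType R[i]) (v : E) : bochner P (fun=> v) = v.
Proof.
have sv := slim_cst v; apply: bochnerE => //; split.
  exact: slim_strongly_measurable.
exists (fun _ _ => v); split => [n||].
- exact: simple_cst.
- under eq_fun do under eq_integral do rewrite subrr normR0.
  by rewrite integral0; exact: cvg_cst.
- by rewrite simple_integral_cst; exact: cvg_cst.
Qed.

Lemma L1_linear (E F : normedModType R[i]) (f : T -> E) (phi : E -> F) M :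
  {morph phi : x y / x - y} -> 0 <= M -> (forall x, normR (phi x) <= M * normR x) ->
  L1 f -> L1 (phi \o f).
Proof.
move=> phiB M0 phiM fL; have [sf _] := fL.
by apply: (L1_le fL (slim_linear phiB phiM sf) M0) => t; exact: phiM.
Qed.

(** Homogeneity is asked for real scalars only, so that the conjugate-linear [cstar] is covered. *)
Lemma bochner_linear (E : completeNormedModType R[i]) (F : normedModType R[i])
    (f : T -> E) (phi : E -> F) M :
  {morph phi : x y / x - y} -> (forall r x, phi (r%:C *: x) = r%:C *: phi x) ->
  0 <= M -> (forall x, normR (phi x) <= M * normR x) ->
  L1 f -> bochner P (phi \o f) = phi (bochner P f).
Proof.
move=> phiB phiZ M0 phiM fL; have [sf _] := fL.
have sphi := slim_linear phiB phiM sf.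
have phi0 : phi 0 = 0 by rewrite -(subrr 0) phiB subrr.
have phiD : {morph phi : x y / x + y}.
  move=> x y; rewrite -{1}(opprK y) phiB; congr (_ + _).
  by rewrite -[- y]sub0r phiB phi0 sub0r opprK.
have [_ [s [ss si sv]]] := L1_bochner fL.
apply: bochnerE => //; split; first exact: slim_strongly_measurable.
exists (fun n => phi \o s n); split => [n||].
- exact: simple_comp.
- apply: (@squeeze_cvge _ _ _ _ (cst 0%E) _
    (fun n => M%:E * \int[P]_t (normR (f t - s n t))%:E)%E).
  + apply: nearW => n; rewrite integral_ge0/=; last first.
      by move=> t _; rewrite lee_fin normR_ge0.
    apply: integral_normR_le => //; first by apply: slimB => //; exact: slim_simple.
    by move=> t; rewrite -phiB.
  + exact: cvg_cst.
  + by rewrite -(mule0 M%:E); apply: cvgeZl.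
- under eq_fun do rewrite (simple_integral_linear P phiD phiZ (ss _)).
  apply: (@cvg_normR_le _ _ _ _
    (fun n => M * normR (simple_integral P (s n) - bochner P f))).
    by rewrite -[X in _ --> X](mulr0 M); apply: cvgMr; exact/cvg_normRP.
  by move=> n; rewrite -phiB.
Qed.

Lemma bochnerD (E : completeNormedModType R[i]) (f g : T -> E) :
  L1 f -> L1 g -> bochner P (fun t => f t + g t) = bochner P f + bochner P g.
Proof.
move=> fL gL; have [sf _] := fL; have [sg _] := gL.
have [_ [s [ss si sv]]] := L1_bochner fL.
have [_ [r [sr ri rv]]] := L1_bochner gL.
have sfg := slimD sf sg.
apply: bochnerE => //; split; first exact: slim_strongly_measurable.
exists (fun n t => s n t + r n t); split => [n||].
- exact: (simple_comp2 (fun x y => x + y)).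
- apply: (@squeeze_cvge _ _ _ _ (cst 0%E) _
    (fun n => \int[P]_t (normR (f t - s n t))%:E +
              \int[P]_t (normR (g t - r n t))%:E)%E).
  + apply: nearW => n; rewrite integral_ge0/=; last first.
      by move=> t _; rewrite lee_fin normR_ge0.
    rewrite -ge0_integralD//; last 4 first.
    * by move=> t _; rewrite lee_fin normR_ge0.
    * by apply: slim_measurableE; apply: slimB => //; exact: slim_simple.
    * by move=> t _; rewrite lee_fin normR_ge0.
    * by apply: slim_measurableE; apply: slimB => //; exact: slim_simple.
    under [leRHS]eq_integral do rewrite -EFinD.
    apply: ge0_le_integralR => t; first exact: normR_ge0.
    by rewrite opprD addrACA normRD.
  + exact: cvg_cst.
  + by rewrite -[X in _ --> X](adde0 0%E); apply: cvgeD.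
- under eq_fun do rewrite simple_integralD//.
  exact: cvgD.
Qed.

Lemma bochnerB (E : completeNormedModType R[i]) (f g : T -> E) :
  L1 f -> L1 g -> bochner P (fun t => f t - g t) = bochner P f - bochner P g.
Proof.
move=> fL gL.
have NB : {morph (-%R : E -> E) : x y / x - y} by move=> x y; rewrite opprD.
have NZ r (x : E) : - (r%:C *: x) = r%:C *: - x by rewrite scalerN.
have NM (x : E) : normR (- x) <= 1 * normR x by rewrite normRN mul1r.
by rewrite (bochnerD fL (L1_linear NB ler01 NM gL)) (bochner_linear NB NZ ler01 NM gL).
Qed.

End Bochner.

(** * Hilbert modules and covariance *)

Section HilbertModule.
Context (R : realType) (A : cstarAlgType R).

(* Positivity of |f - g a|^2 for a = c / M, with M slightly above the norm of
   q = <g, g>, where p = <f, f> and c = <g, f>. *)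
Lemma apos_cauchy_schwarz (p q c : A) : cstar q = q ->
  (forall a, apos (p - cmul (cstar c) a - cmul (cstar a) c +
                   cmul (cstar a) (cmul q a))) ->
  normR c ^+ 2 <= normR q * normR p.
Proof.
move=> sq H.
have le M : normR q < M -> normR c ^+ 2 <= M * normR p.
  move=> qM; have M0 : 0 < M := le_lt_trans (normR_ge0 _) qM.
  have Mi : 0 <= M^-1 by rewrite invr_ge0 ltW.
  have Mc : M^-1%:C = (M^-1%:C)^* by apply/eqP; rewrite eq_complex/= oppr0 !eqxx.
  set k := cmul (cstar c) c; set l := cmul (cstar c) (cmul q c).
  have H1 := H (M^-1%:C *: c).
  (* [H1] is the positivity of p - 2 k / M + l / M^2; adding [H2] cancels l and leaves p - k / M. *)
  have H2 : apos ((M^-1 * M^-1)%:C *: (M%:C *: k - l)).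
    by apply: aposZ; [exact: mulr_ge0|apply: apos_conj_le => //; exact: ltW].
  have H3 : apos (p - M^-1%:C *: k).
    have := aposD H1 H2; congr (apos _).
    rewrite cstarZ -Mc !cmulZr !cmulZl scalerA -rmorphM/= -/k -/l.
    rewrite scalerBr scalerA -rmorphM/= -mulrA mulVf ?gt_eqF// mulr1.
    by rewrite addrA [LHS](ACl (1*2*3*5*4*6))/= addrK subrK.
  have := normR_aposD (aposZ Mi (apos_starM c)) H3.
  rewrite addrC subrK normRZ ger0_norm// cstar_normR.
  by rewrite mulrC ler_pdivrMr// mulrC.
have [p0|p0] := eqVneq (normR p) 0.
  by have := le (normR q + 1); rewrite p0 !mulr0; apply; rewrite ltrDl.
have pp : 0 < normR p by rewrite lt_neqAle eq_sym p0 normR_ge0.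
apply/ler_addgt0Pr => e e0.
have := le (normR q + e / normR p); rewrite mulrDl divfK//; apply.
by rewrite ltrDl divr_gt0.
Qed.

Context (X : hilbertModType A).
Implicit Types x y z : X.

Lemma ipDl x y z : ip (x + y) z = ip x z + ip y z.
Proof. by rewrite -(ip_star z (x + y)) ipDr cstarD !ip_star. Qed.

Lemma ip0r x : ip x 0 = 0.
Proof. by apply: (@addrI _ (ip x 0)); rewrite -ipDr !addr0. Qed.

Lemma ipNr x y : ip x (- y) = - ip x y.
Proof. by apply: (@addrI _ (ip x y)); rewrite -ipDr !subrr ip0r. Qed.

Lemma ipBr x y z : ip x (y - z) = ip x y - ip x z.
Proof. by rewrite ipDr ipNr. Qed.

Lemma ipBl x y z : ip (x - y) z = ip x z - ip y z.
Proof. by rewrite -ip_star ipBr cstarD cstarN !ip_star. Qed.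

Lemma ipZl (r : R) x y : ip (r%:C *: x) y = r%:C *: ip x y.
Proof.
rewrite -ip_star ipZr cstarZ ip_star; congr (_ *: _).
by apply/eqP; rewrite eq_complex/= oppr0 !eqxx.
Qed.

Lemma ip_ractl x y a : ip (ract x a) y = cmul (cstar a) (ip x y).
Proof. by rewrite -ip_star ip_ract cstarM ip_star. Qed.

Lemma absq_normR x : normR (ip x x) = normR x ^+ 2.
Proof. by apply: (@complexI R); rewrite rmorphXn/= !normRE ip_norm. Qed.

Lemma apos_ip x : apos (ip x x).
Proof. by have [b ->] := ip_ge0 x; exact: apos_starM. Qed.

Lemma ip_expand x y a : ip (x - ract y a) (x - ract y a) =
  ip x x - cmul (cstar (ip y x)) a - cmul (cstar a) (ip y x) +
  cmul (cstar a) (cmul (ip y y) a).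
Proof.
rewrite ipBl !ipBr ip_ract !ip_ractl ip_star ip_ract.
by rewrite opprB addrA addrAC.
Qed.

Lemma ip_normR x y : normR (ip x y) <= normR x * normR y.
Proof.
have := apos_cauchy_schwarz (p := ip x x) (c := ip y x) (ip_star y y).
rewrite !absq_normR -exprMn mulrC => H.
rewrite -ip_star normR_star -ler_sqr ?nnegrE ?mulr_ge0 ?normR_ge0//.
by apply: H => a; rewrite -ip_expand; exact: apos_ip.
Qed.

Lemma ract_normR x a : normR (ract x a) <= normR a * normR x.
Proof.
rewrite -ler_sqr ?nnegrE ?mulr_ge0 ?normR_ge0// -absq_normR ip_ractl ip_ract.
rewrite (le_trans (cmul_normR _ _))// normR_star exprMn -absq_normR.
rewrite [in leRHS]expr2 -mulrA ler_wpM2l ?normR_ge0// mulrC.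
exact: cmul_normR.
Qed.

Lemma ractBl x y a : ract (x - y) a = ract x a - ract y a.
Proof.
have r0 : ract (0 : X) a = 0.
  by apply: (@addrI _ (ract (0 : X) a)); rewrite -ractDl !addr0.
have rN : ract (- y) a = - ract y a.
  by apply: (@addrI _ (ract y a)); rewrite -ractDl !subrr.
by rewrite ractDl rN.
Qed.

Lemma cvg_ip (u v : nat -> X) x y : u n @[n --> \oo] --> x ->
  v n @[n --> \oo] --> y -> ip (u n) (v n) @[n --> \oo] --> ip x y.
Proof.
move=> ux vy; apply: (@cvg_normR_le _ _ _ _ (fun n =>
    normR (u n - x) * normR (v n) + normR x * normR (v n - y))).
  rewrite -[X in _ --> X](addr0 (0 : R)) -[X in _ --> X + _](mul0r (normR y)).
  rewrite -[X in _ --> _ + X](mulr0 (normR x)).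
  apply: cvgD; apply: cvgM; try exact: cvg_cst; try exact: normR_cvg.
  - exact/cvg_normRP.
  - exact/cvg_normRP.
move=> n; have -> : ip (u n) (v n) - ip x y = ip (u n - x) (v n) + ip x (v n - y).
  by rewrite ipBl ipBr addrA subrK.
by rewrite (le_trans (normRD _ _))// lerD// ip_normR.
Qed.

(* with m = (x + x') / 2 and h = v - m, this is
   Re <(x' - x) / 2 - h, (x' - x) / 2 + h> = |x' - x|^2 / 4 - |h|^2 *)
Lemma cRe_ip x x' v : cRe (ip (x' - v) (v - x)) =
  (4^-1 : R[i]) *: absq (x' - x) - absq (v - (2^-1 : R[i]) *: (x' + x)).
Proof.
have r2 : (2^-1 : R[i]) = (2^-1 : R)%:C by rewrite fmorphV/= rmorph_nat.
have r4 : (4^-1 : R[i]) = (4^-1 : R)%:C by rewrite fmorphV/= rmorph_nat.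
pose h := v - (2^-1 : R[i]) *: (x' + x); pose u := (2^-1 : R[i]) *: (x' - x).
have dbl (V : lmodType R[i]) (w : V) : (2^-1 : R[i]) *: (w + w) = w.
  by rewrite scalerDr -scalerDl -[RHS]scale1r [in RHS](splitr 1) mul1r.
have uh : (2^-1 : R[i]) *: (x' - x) + (2^-1 : R[i]) *: (x' + x) = x'.
  by rewrite -scalerDr addrACA addNr addr0 dbl.
have hu : (2^-1 : R[i]) *: (x' + x) - (2^-1 : R[i]) *: (x' - x) = x.
  by rewrite -scalerBr opprB addrC addrA subrK dbl.
have -> : x' - v = u - h by rewrite /h opprB addrA uh.
have -> : v - x = u + h by rewrite -{1}hu opprB addrCA.
have -> : (4^-1 : R[i]) *: absq (x' - x) = ip u u.
  rewrite /u /absq r2 ipZl ipZr scalerA -rmorphM/= r4; congr (_%:C *: _).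
  by rewrite -invfM -natrM.
rewrite -/h; clearbody h u.
rewrite /absq /cRe ip_star !ipBl !ipDl !ipBr !ipDr !opprD !addrA.
rewrite [X in _ *: X](ACl (1*4*5*8*2*6*3*7))/= addrK subrK -addrA.
exact: dbl.
Qed.

End HilbertModule.

(** The [A]-valued form E <f, g>, locked so that unification does not unfold it to [bochner]. *)
HB.lock Definition bip (R : realType) d (T : measurableType d)
    (P : probability T R) (A : cstarAlgType R) (X : hilbertModType A)
    (f g : T -> X) : A :=
  bochner P (fun t => ip (f t) (g t)).

(** * The form E <f, g> and the chain of inequalities *)

Section GrussChain.
Context (R : realType) d (T : measurableType d) (P : probability T R)
  (A : cstarAlgType R) (X : hilbertModType A).
Implicit Types (f g h : T -> X) (x y : X).

Definition sqint f :=
  slim f /\ (\int[P]_t (normR (f t) ^+ 2)%:E < +oo)%E.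

Lemma measurable_sqr f : slim f -> measurable_fun setT (fun t => normR (f t) ^+ 2).
Proof. by move=> sf; apply: measurable_funX; exact: slim_measurable. Qed.

Lemma sqint_sum f g : sqint f -> sqint g ->
  (\int[P]_t (normR (f t) ^+ 2 + normR (g t) ^+ 2)%:E < +oo)%E.
Proof.
move=> [sf fi] [sg gi]; under eq_integral do rewrite EFinD.
rewrite ge0_integralD//; last 4 first.
- by move=> t _; rewrite lee_fin sqr_ge0.
- by apply/measurable_EFinP; exact: measurable_sqr.
- by move=> t _; rewrite lee_fin sqr_ge0.
- by apply/measurable_EFinP; exact: measurable_sqr.
exact: lte_add_pinfty.
Qed.

Lemma sqint_cst x : sqint (fun=> x).
Proof.
split; first exact: slim_cst.
rewrite integral_cst// [X in (_ * X)%E]probability_setT mule1; exact: ltry.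
Qed.

Lemma sqintB f g : sqint f -> sqint g -> sqint (fun t => f t - g t).
Proof.
move=> fL gL; have [sf _] := fL; have [sg _] := gL; split; first exact: slimB.
apply: le_lt_trans (_ : (_ <=
    \int[P]_t (2%:E * (normR (f t) ^+ 2 + normR (g t) ^+ 2)%:E))%E) _.
  under [leRHS]eq_integral do rewrite -EFinM.
  apply: ge0_le_integralR => t; first exact: sqr_ge0.
  have := normRB (f t) (g t); have := normR_ge0 (f t - g t).
  have := sqr_ge0 (normR (f t) - normR (g t)); nra.
rewrite ge0_integralZl//; last 2 first.
- by apply/measurable_EFinP; apply: measurable_funD; exact: measurable_sqr.
- by move=> t _; rewrite lee_fin addr_ge0// sqr_ge0.
by rewrite lte_mul_pinfty// sqint_sum.
Qed.

Lemma sqint_ract f a : sqint f -> sqint (fun t => ract (f t) a).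
Proof.
move=> [sf fi]; split.
  have rB : {morph (fun x : X => ract x a) : x y / x - y}.
    by move=> x y; exact: ractBl.
  exact: (slim_linear rB (fun x => ract_normR x a) sf).
apply: le_lt_trans (_ : (_ <= \int[P]_t ((normR a ^+ 2)%:E * (normR (f t) ^+ 2)%:E))%E) _.
  under [leRHS]eq_integral do rewrite -EFinM.
  apply: ge0_le_integralR => t; first exact: sqr_ge0.
  by rewrite -exprMn lerXn2r ?nnegrE ?mulr_ge0 ?normR_ge0// ract_normR.
rewrite ge0_integralZl//; last 3 first.
- by apply/measurable_EFinP; exact: measurable_sqr.
- by move=> t _; rewrite lee_fin sqr_ge0.
- by rewrite lee_fin sqr_ge0.
by rewrite lte_mul_pinfty// lee_fin sqr_ge0.
Qed.

Lemma sqint_L1 f : sqint f -> L1 P f.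
Proof.
move=> fL; have [sf fi] := fL; split => //.
apply: le_lt_trans (_ : (_ <= \int[P]_t (1 + normR (f t) ^+ 2)%:E)%E) _.
  apply: ge0_le_integralR => t; first exact: normR_ge0.
  by have := sqr_ge0 (normR (f t) - 1); have := normR_ge0 (f t); nra.
under eq_integral do rewrite EFinD; rewrite ge0_integralD//; last 2 first.
- by move=> t _; rewrite lee_fin sqr_ge0.
- by apply/measurable_EFinP; exact: measurable_sqr.
rewrite integral_cst// [X in (_ * X)%E]probability_setT mule1.
by apply: lte_add_pinfty => //; exact: ltry.
Qed.

Lemma slim_ip f g : slim f -> slim g -> slim (fun t => ip (f t) (g t)).
Proof. by apply: (slim_comp2 (phi := @ip R A X)) => u v x y; exact: cvg_ip. Qed.

Lemma L1_ip f g : sqint f -> sqint g -> L1 P (fun t => ip (f t) (g t)).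
Proof.
move=> fL gL; have [sf _] := fL; have [sg _] := gL; split; first exact: slim_ip.
apply: le_lt_trans (sqint_sum fL gL).
apply: ge0_le_integralR => t; first exact: normR_ge0.
have := ip_normR (f t) (g t); have := sqr_ge0 (normR (f t) - normR (g t)).
by have := normR_ge0 (f t); have := normR_ge0 (g t); nra.
Qed.

Local Notation bip := (bip P).

Lemma bip_star f g : sqint f -> sqint g -> cstar (bip f g) = bip g f.
Proof.
move=> fL gL; rewrite bip.unlock -(bochner_linear (phi := @cstar R A) (M := 1)).
- by congr bochner; apply/funext => t /=; rewrite ip_star.
- by move=> a b; rewrite cstarD cstarN.
- move=> r a; rewrite cstarZ; congr (_ *: _).
  by apply/eqP; rewrite eq_complex/= oppr0 !eqxx.
- exact: ler01.
- by move=> a; rewrite normR_star mul1r.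
- exact: L1_ip.
Qed.

Lemma bipBr f g h : sqint f -> sqint g -> sqint h ->
  bip f (fun t => g t - h t) = bip f g - bip f h.
Proof.
move=> fL gL hL; rewrite bip.unlock -bochnerB; [|exact: L1_ip|exact: L1_ip].
by congr bochner; apply/funext => t; rewrite ipBr.
Qed.

Lemma bipBl f g h : sqint f -> sqint g -> sqint h ->
  bip (fun t => f t - g t) h = bip f h - bip g h.
Proof.
move=> fL gL hL; rewrite bip.unlock -bochnerB; [|exact: L1_ip|exact: L1_ip].
by congr bochner; apply/funext => t; rewrite ipBl.
Qed.

Lemma bip_ract f g a : sqint f -> sqint g ->
  bip f (fun t => ract (g t) a) = cmul (bip f g) a.
Proof.
move=> fL gL; rewrite bip.unlock.
rewrite -(bochner_linear (phi := fun b => cmul b a) (M := normR a)).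
- by congr bochner; apply/funext => t /=; rewrite ip_ract.
- by move=> b c; rewrite cmulDl -(scaleN1r c) cmulZl scaleN1r.
- by move=> r b; rewrite cmulZl.
- exact: normR_ge0.
- by move=> b; rewrite mulrC cmul_normR.
- exact: L1_ip.
Qed.

Lemma bip_cstl x g : sqint g -> bip (fun=> x) g = ip x (bochner P g).
Proof.
move=> gL; rewrite bip.unlock -(bochner_linear (phi := ip x) (M := normR x))//.
- by move=> y z; exact: ipBr.
- by move=> r y; rewrite ipZr.
- exact: normR_ge0.
- by move=> y; exact: ip_normR.
- exact: sqint_L1.
Qed.

Lemma bip_cstr f y : sqint f -> bip f (fun=> y) = ip (bochner P f) y.
Proof.
move=> fL; have yL := sqint_cst y.
by rewrite -(bip_star yL fL) bip_cstl// ip_star.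
Qed.

(** For simple s the integral of <s, s> is a combination of elements <v, v> with nonnegative
    weights. The general case follows because the cone is closed. *)
Lemma apos_bip f : sqint f -> apos (bip f f).
Proof.
move=> fL; rewrite bip.unlock; have [sf fi] := fL; have [s [ss cs sb]] := slim_approx sf.
have sif := slim_ip sf sf.
have ssi n : simple_fun (fun t => ip (s n t) (s n t)) by exact: simple_comp2.
have is0 : (\int[P]_t (normR (ip (f t) (f t) - ip (s n t) (s n t)))%:E)%E
    @[n --> \oo] --> 0%E.
  (* |s n| <= 2 |f| gives |<f, f> - <s n, s n>| <= |f|^2 + 4 |f|^2. *)
  apply: (@dominated_normR _ _ _ _ _ _ _ (fun t => 5 * normR (f t) ^+ 2)) => //.
  - by move=> t; exact: cvg_ip.
  - by apply: measurable_funM => //; exact: measurable_sqr.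
  - move=> n t; rewrite (le_trans (normRB _ _))// !absq_normR.
    have := sb n t; have := normR_ge0 (s n t); have := normR_ge0 (f t).
    nra.
  - under eq_integral do rewrite EFinM.
    rewrite ge0_integralZl//.
    + by rewrite lte_mul_pinfty.
    + by apply/measurable_EFinP; exact: measurable_sqr.
    + by move=> t _; rewrite lee_fin sqr_ge0.
have Ib := L1_bochner (L1_ip fL fL).
have posI n : apos (simple_integral P (fun t => ip (s n t) (s n t))).
  rewrite (simple_integral_comp P (fun x => ip x x) (ss n)).
  apply: (@big_ind _ (@apos R A)).
  - by rewrite /apos raddf0 -(raddf0 (@scl R A)); exact: upos_scl.
  - exact: aposD.
  - by move=> v _; apply: aposZ (apos_ip _); exact: pr_ge0.
apply: apos_closed => e e0.
have [n _ Hn] := cvge0_near is0 e0.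
(* The integral is given as a limit along some sequence r of its own; r is compared with <s n, s n>
   through their mean distances to <f, f>. *)
have [_ [r [sr ir rv]]] := Ib.
have /cvg_normRP/cvgrPdist_le Hr := rv.
exists (simple_integral P (fun t => ip (s n t) (s n t))); first exact: posI.
apply/ler_addgt0Pr => e' e'0; have e20 : 0 < e' / 2 by rewrite divr_gt0.
have [m _ Hm] := filterI (Hr _ e20) (cvge0_near ir e20).
have [Hm1 Hm2] := Hm m (leqnn _).
have H3 := simple_integral_dist P sif (sr m) (ssi n).
have H4 := le_trans H3 (leeD Hm2 (Hn n (leqnn _))).
rewrite -EFinD lee_fin in H4.
rewrite sub0r normrN ger0_norm ?normR_ge0// in Hm1.
rewrite -(subrKA (simple_integral P (r m))) (le_trans (normRD _ _))//.
rewrite (normR_distC (bochner P _)); lra.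
Qed.

(** Taking x = E f and y = E g centres the covariance; g = f and x = y = m give the decomposition of
    E |f - m|^2. *)
Lemma bip_shift f g x y : sqint f -> sqint g ->
  bip (fun t => f t - x) (fun t => g t - y) =
  bip f g - ip x (bochner P g) - ip (bochner P f) y + ip x y.
Proof.
move=> fL gL; have xL := sqint_cst x; have yL := sqint_cst y.
rewrite bipBl//; last exact: sqintB.
rewrite !bipBr// !bip_cstl// bip_cstr// bochner_cst.
by rewrite opprB addrA [LHS](ACl (1*4*2*3)).
Qed.

Definition center f : T -> X := fun t => f t - bochner P f.

Lemma sqint_center f : sqint f -> sqint (center f).
Proof. by move=> fL; apply: sqintB => //; exact: sqint_cst. Qed.

Lemma cov_center f g : sqint f -> sqint g -> cov P f g = bip (center f) (center g).
Proof. by move=> fL gL; rewrite bip_shift// subrK bip.unlock. Qed.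

Lemma sqdist_shift f m : sqint f ->
  bochner P (fun t => absq (f t - m)) = Defs.variance P f + absq (bochner P f - m).
Proof.
move=> fL; have := bip_shift m m fL fL; rewrite bip.unlock => ->.
rewrite /Defs.variance /absq ipBl !ipBr opprB !addrA.
by rewrite [RHS](ACl (1*2*3*6*4*5))/= subrK.
Qed.

(** The abstract inequality applies because E |f - g a|^2 is positive for every constant a in
    [A]. *)
Lemma bip_cauchy_schwarz f g : sqint f -> sqint g ->
  normR (bip f g) ^+ 2 <= normR (bip f f) * normR (bip g g).
Proof.
move=> fL gL; rewrite mulrC.
have sfg : normR (bip g f) = normR (bip f g).
  by have := normR_star (bip f g); rewrite (bip_star fL gL).
have := @apos_cauchy_schwarz R A (bip f f) (bip g g) (bip g f) (bip_star gL gL).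
rewrite sfg; apply => a; have ga := sqint_ract a gL.
have e1 : bip f (fun t => ract (g t) a) = cmul (cstar (bip g f)) a.
  by rewrite (bip_star gL fL); exact: bip_ract.
have e2 : bip (fun t => ract (g t) a) f = cmul (cstar a) (bip g f).
  by have := bip_star fL ga; rewrite e1 cstarM cstarK => <-.
have e3 : bip (fun t => ract (g t) a) (fun t => ract (g t) a) =
    cmul (cstar a) (cmul (bip g g) a).
  have e4 : bip (fun t => ract (g t) a) g = cmul (cstar a) (bip g g).
    have := bip_star gL ga; rewrite (bip_ract a gL gL) cstarM.
    by rewrite (bip_star gL gL) => <-.
  by rewrite (bip_ract a ga gL) e4 cmulA.
have := apos_bip (sqintB fL ga).
rewrite (bipBl fL ga (sqintB fL ga)) (bipBr fL fL ga) (bipBr ga fL ga) e1 e2 e3.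
by rewrite opprB addrA addrAC.
Qed.

Lemma cov_bound f g : sqint f -> sqint g ->
  normR (cov P f g) <= variance_bound P f g.
Proof.
move=> fL gL; rewrite /variance_bound -sqrtrM ?normR_ge0//.
have vE h : sqint h -> Defs.variance P h = bip (center h) (center h).
  by move=> hL; rewrite -cov_center.
rewrite (vE f fL) (vE g gL) (cov_center fL gL).
have le_sqrt (a b : R) : 0 <= a -> a ^+ 2 <= b -> a <= Num.sqrt b.
  by move=> a0 ab; rewrite -(ger0_norm a0) -sqrtr_sqr ler_wsqrtr.
apply: le_sqrt (normR_ge0 _) _.
exact: bip_cauchy_schwarz (sqint_center fL) (sqint_center gL).
Qed.

Lemma re_integralE f x x' : sqint f ->
  re_integral P x x' f =
  (4^-1 : R[i]) *: absq (x' - x) - sqdist_integral P x x' f.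
Proof.
move=> fL; rewrite /re_integral /sqdist_integral.
under eq_fun do rewrite cRe_ip.
rewrite bochnerB ?bochner_cst//; first exact: L1_cst.
by apply: L1_ip; apply: sqintB => //; exact: sqint_cst.
Qed.

Lemma apos_variance f : sqint f -> apos (Defs.variance P f).
Proof.
move=> fL; have -> : Defs.variance P f = bip (center f) (center f) by rewrite -cov_center.
by apply: apos_bip; exact: sqint_center.
Qed.

Lemma variance_le f x x' : sqint f ->
  normR (Defs.variance P f) <=
  normR ((4^-1 : R[i]) *: absq (x' - x) - re_integral P x x' f).
Proof.
move=> fL; rewrite re_integralE// subKr /sqdist_integral sqdist_shift//.
by apply: normR_aposD; [exact: apos_variance|exact: apos_ip].
Qed.

Lemma defect_le f x x' : sqint f -> cle 0 (re_integral P x x' f) ->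
  normR ((4^-1 : R[i]) *: absq (x' - x) - re_integral P x x' f) <=
  (2^-1 * normR (x' - x)) ^+ 2.
Proof.
move=> fL; rewrite /cle subr0 => -[b bE].
have pr : apos (re_integral P x x' f) by rewrite bE; exact: apos_starM.
have -> : (2^-1 * normR (x' - x)) ^+ 2 = normR ((4^-1 : R[i]) *: absq (x' - x)).
  rewrite exprMn -absq_normR (_ : 4^-1 = (4^-1 : R)%:C); last first.
    by rewrite fmorphV/= rmorph_nat.
  rewrite normRZ ger0_norm ?invr_ge0//; congr (_ * _).
  by rewrite exprVn -natrX.
(* |x' - x|^2 / 4 is split into E |f - m|^2 and the integral that is positive by hypothesis. *)
rewrite -[in leRHS](subrK (re_integral P x x' f) (_ *: _)).
apply: normR_aposD => //; rewrite re_integralE// subKr /sqdist_integral.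
rewrite sqdist_shift//; apply: aposD; [exact: apos_variance|exact: apos_ip].
Qed.

Lemma gruss_chain f g x x' y y' : sqint f -> sqint g ->
  cle 0 (re_integral P x x' f) -> cle 0 (re_integral P y y' g) ->
  [/\ normR (cov P f g) <= variance_bound P f g,
      variance_bound P f g <= defect_bound P x x' y y' f g
    & defect_bound P x x' y y' f g <= 4^-1 * (normR (x' - x) * normR (y' - y))].
Proof.
move=> fL gL fr gr; split; first exact: cov_bound.
  by rewrite ler_pM ?sqrtr_ge0// ler_wsqrtr// variance_le.
have -> : 4^-1 * (normR (x' - x) * normR (y' - y)) =
    (2^-1 * normR (x' - x)) * (2^-1 * normR (y' - y)).
  by rewrite mulrACA -invfM -natrM.
have sq (z : X) : Num.sqrt ((2^-1 * normR z) ^+ 2) = 2^-1 * normR z.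
  by rewrite sqrtr_sqr ger0_norm// mulr_ge0 ?invr_ge0 ?normR_ge0.
by rewrite ler_pM ?sqrtr_ge0// -sq ler_wsqrtr// defect_le.
Qed.

Lemma L2_sqint f : L2 P f ->
  exists2 g, sqint g & {ae P, forall t, f t = g t}.
Proof.
move=> [/strongly_measurable_slim[g sg fg] fi]; exists g => //; split => //.
apply: le_lt_trans fi; apply: ae_le_integralR => [t|t|]; try exact: sqr_ge0.
by apply: filterS fg => t ->.
Qed.

End GrussChain.

(** * Sharpness *)

(** The complex numbers under a name of their own, to carry the C*-algebra structure and that of a
    Hilbert module over themselves. *)
Definition scalars (R : realType) : Type := R[i]^o.
HB.instance Definition _ (R : realType) := NormedModule.on (scalars R).

Section Scalars.
Context (R : realType).
Implicit Types z w : R[i].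

Lemma Re_le_norm z : `|complex.Re z|%:C <= `|z|.
Proof.
case: z => a b; rewrite normc_def lecR -sqrtr_sqr ler_wsqrtr//=.
by rewrite lerDl sqr_ge0.
Qed.

Lemma Im_le_norm z : `|complex.Im z|%:C <= `|z|.
Proof.
case: z => a b; rewrite normc_def lecR -sqrtr_sqr ler_wsqrtr//=.
by rewrite lerDr sqr_ge0.
Qed.

Lemma norm_le_ReIm z : `|z| <= (`|complex.Re z| + `|complex.Im z|)%:C.
Proof.
case: z => a b; rewrite normc_def lecR /= -[leRHS]ger0_norm ?addr_ge0//.
rewrite -sqrtr_sqr ler_wsqrtr// sqrrD !real_normK ?num_real//.
by rewrite addrAC lerDl mulrn_wge0// mulr_ge0.
Qed.

(** Real and imaginary parts are additive and do not increase the norm, so both images of a Cauchy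
    filter converge in [R]. *)
Lemma scalars_complete (F : set_system (scalars R)) :
  ProperFilter F -> cauchy F -> cvg F.
Proof.
move=> PF cF.
have part (p : R[i] -> R) : (forall z w, p (z - w) = p z - p w) ->
    (forall z, `|p z|%:C <= `|z|) -> cvg (p @ F).
  move=> pB pn; apply: cauchy_cvg; apply: cauchy_exP => e e0.
  have e0' : 0 < e%:C by rewrite ltcR.
  have /cauchyP/(_ _ e0')[z Hz] := cF.
  exists (p z); change (F (p @^-1` ball (p z) e)); move: Hz; apply: filterS => w zw.
  rewrite /= -ball_normE /= -pB -ltcR; apply: le_lt_trans (pn _) _.
  by move: zw; rewrite -ball_normE.
have /cvg_ex[a Fa] := part (@complex.Re R) (fun z w => raddfB _ z w) Re_le_norm.
have /cvg_ex[b Fb] := part (@complex.Im R) (fun z w => raddfB _ z w) Im_le_norm.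
apply/cvg_ex; exists (a +i* b : scalars R); apply/cvgrPdist_lt => e e0.
have eE : e = (complex.Re e)%:C by rewrite RRe_real// gtr0_real.
have e20 : 0 < complex.Re e / 2 by rewrite divr_gt0// -ltcR -eE.
move/cvgrPdist_lt : Fa => /(_ _ e20); move/cvgrPdist_lt : Fb => /(_ _ e20).
apply: filterS2 => z /= zb za; apply: le_lt_trans (norm_le_ReIm _) _.
rewrite eE ltcR [ltRHS]splitr; case: z zb za => c d' /= zb za.
exact: ltrD.
Qed.

HB.instance Definition _ :=
  Uniform_isComplete.Build (scalars R) scalars_complete.

End Scalars.

Section ScalarInstances.
Context (R : realType).
Local Notation C := (scalars R).
Implicit Types (l a b c : R[i]).

Definition smul (a b : C) : C := (a : R[i]) * (b : R[i]).
Definition sstar (a : C) : C := (a : R[i])^*.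

Lemma smulA : forall a b c : C, smul a (smul b c) = smul (smul a b) c.
Proof. by move=> a b c; exact: mulrA. Qed.
Lemma smulDl : forall a b c : C, smul (a + b) c = smul a c + smul b c.
Proof. by move=> a b c; exact: mulrDl. Qed.
Lemma smulDr : forall a b c : C, smul a (b + c) = smul a b + smul a c.
Proof. by move=> a b c; exact: mulrDr. Qed.
Lemma smulZl : forall l (a b : C), smul (l *: a) b = l *: smul a b.
Proof. by move=> l a b; rewrite /smul -[l *: a]/(l * _) -mulrA. Qed.
Lemma smulZr : forall l (a b : C), smul a (l *: b) = l *: smul a b.
Proof. by move=> l a b; rewrite /smul -[l *: b]/(l * _) mulrCA. Qed.
Lemma smul_norm : forall a b : C, `|smul a b| <= `|a| * `|b|.
Proof. by move=> a b; rewrite [leLHS](normrM (a : R[i]) b). Qed.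
Lemma sstarK : forall a : C, sstar (sstar a) = a.
Proof. by move=> a; exact: conjCK. Qed.
Lemma sstarD : forall a b : C, sstar (a + b) = sstar a + sstar b.
Proof. by move=> a b; rewrite /sstar rmorphD. Qed.
Lemma sstarZ : forall l (a : C), sstar (l *: a) = l^* *: sstar a.
Proof. by move=> l a; exact: (rmorphM Num.conj). Qed.
Lemma sstarM : forall a b : C, sstar (smul a b) = smul (sstar b) (sstar a).
Proof. by move=> a b; rewrite /sstar /smul rmorphM mulrC. Qed.
Lemma sstar_norm : forall a : C, `|smul (sstar a) a| = `|a| ^+ 2.
Proof.
by move=> a; rewrite /smul [LHS](normrM (sstar a : R[i]) a) /sstar norm_conjC.
Qed.

HB.instance Definition _ := CompleteNormedModule_isCStarAlgebra.Build R C
  smulA smulDl smulDr smulZl smulZr smul_norm sstarK sstarD sstarZ sstarM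
  sstar_norm.

Definition sip (a b : C) : C := cmul (cstar a) b.

Lemma sipDr (a b c : C) : sip a (b + c) = sip a b + sip a c.
Proof. exact: cmulDr. Qed.
Lemma sipZr l (a b : C) : sip a (l *: b) = l *: sip a b.
Proof. exact: cmulZr. Qed.
Lemma sip_smul (a b c : C) : sip a (cmul b c) = cmul (sip a b) c.
Proof. exact: cmulA. Qed.
Lemma sip_star (a b : C) : cstar (sip a b) = sip b a.
Proof. by rewrite /sip cstarM cstarK. Qed.
Lemma sip_ge0 (a : C) : cpos (sip a a).
Proof. by exists a. Qed.
Lemma sip_norm (a : C) : `|a| ^+ 2 = `|sip a a|.
Proof. by rewrite cstar_norm. Qed.
Lemma sip_eq0 (a : C) : sip a a = 0 -> a = 0.
Proof.
move=> a0; apply/eqP; rewrite -normr_eq0; apply/eqP.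
by apply/eqP; rewrite -sqrf_eq0 sip_norm a0 normr0.
Qed.
HB.instance Definition _ := CompleteNormedModule_isHilbertModule.Build R C C
  smulDl smulDr smulA smulZl smulZr sipDr sipZr sip_smul sip_star sip_ge0
  sip_eq0 sip_norm.

End ScalarInstances.

(** A function with values in {x, x'} satisfies the hypothesis with equality. *)
Lemma cRe_ip_endpoint (R : realType) (A : cstarAlgType R) (X : hilbertModType A)
  (x x' v : X) : v = x \/ v = x' -> cRe (ip (x' - v) (v - x)) = 0.
Proof.
move=> vx; have -> : ip (x' - v) (v - x) = 0.
  by case: vx => ->; rewrite subrr ?ip0r// -ip_star ip0r cstar0.
by rewrite /cRe cstar0 addr0 scaler0.
Qed.

(** * The extremal example *)

Section FairCoin.
Context (R : realType).
Local Notation C := (scalars R).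
Local Notation P := (bernoulli_prob (2^-1 : R)).

Definition coin (b : bool) : C := if b then (1 : R[i]) else (- 1 : R[i]).

Lemma normR_coin b : normR (coin b) = 1.
Proof.
apply: (@complexI R); rewrite normRE; case: b; first exact: (@normr1 R[i]).
by rewrite [LHS](@normrN1 R[i]).
Qed.

(** [coin true] stands for the number 1, as [scalars] is not declared as a ring. *)
Lemma coin_absq b : absq (coin b) = coin true.
Proof.
by case: b; rewrite /absq /ip/= /sip /cmul/= /smul /cstar/= /sstar ?rmorphN
  rmorph1 ?mulrNN mulr1.
Qed.

Lemma simple_coin : simple_fun coin.
Proof. by split => //; exact/finite_image/finite_finset. Qed.

Lemma pr_id_coin b : pr P (@id bool) b = 2^-1.
Proof.
rewrite /pr preimage_id /= /bernoulli_prob ifT; last lra.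
by rewrite fsbig_set1 /bernoulli_pmf; case: b => //=; lra.
Qed.

Lemma bochner_coin : bochner P coin = 0.
Proof.
have -> : bochner P coin = simple_integral P coin.
  apply: bochnerE; first exact: slim_simple simple_coin.
  split; first exact/slim_strongly_measurable/slim_simple/simple_coin.
  exists (fun=> coin); split => [n||].
  - exact: simple_coin.
  - under eq_fun do under eq_integral do rewrite subrr normR0.
    by rewrite integral0; exact: cvg_cst.
  - exact: cvg_cst.
(* Viewed as [coin] composed with the identity, the integral is a sum over the two booleans, each of
   weight 1/2. *)
have sid : simple_fun (@id bool) by split => //; exact/finite_image/finite_finset.
rewrite (simple_integral_comp P coin sid).
under eq_bigr do rewrite pr_id_coin.
rewrite -scaler_sumr (_ : range id = [set true; false]); last first.
  by apply/seteqP; split => [[] _|[] _]; [left|right|exists true|exists false].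
rewrite fset_setU1// fset_set1 big_fsetU1 ?inE//= big_seq_fset1.
by rewrite (_ : coin true + coin false = 0) ?scaler0//; exact: (@subrr R[i]).
Qed.

Lemma L2_coin : L2 P coin.
Proof.
split; first exact/slim_strongly_measurable/slim_simple/simple_coin.
under eq_integral do rewrite normR_coin expr1n.
by rewrite integral_cst// [X in (_ * X)%E]probability_setT mule1; exact: ltry.
Qed.

Lemma variance_coin : normR (Defs.variance P coin) = 1.
Proof.
rewrite /Defs.variance bochner_coin.
rewrite (_ : (fun t => absq (coin t)) = (fun=> coin true)); last first.
  by apply/funext => b; exact: coin_absq.
by rewrite bochner_cst /absq ip0r subr0 normR_coin.
Qed.

Lemma re_integral_coin : re_integral P (coin false) (coin true) coin = 0.
Proof.
rewrite /re_integral (_ : (fun t => _) = (fun=> 0)) ?bochner_cst//.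
by apply/funext => -[]; apply: cRe_ip_endpoint; [right|left].
Qed.

Lemma re_integral_coin_ge0 : cle 0 (re_integral P (coin false) (coin true) coin).
Proof.
by exists 0; rewrite re_integral_coin cstar0 cmul0l subr0.
Qed.

Lemma normR_coinB : normR (coin true - coin false) = 2.
Proof.
have -> : coin true - coin false = 2%:C *: coin true.
  rewrite [RHS](_ : _ = (2%:C : R[i]) * 1)// mulr1 [LHS](_ : _ = 1 - -1 :> R[i])//.
  by rewrite opprK rmorph_nat.
by rewrite normRZ normR_coin mulr1 ger0_norm.
Qed.

Lemma variance_bound_coin : variance_bound P coin coin = 1.
Proof. by rewrite /variance_bound variance_coin sqrtr1 mulr1. Qed.

Lemma defect_bound_coin : defect_bound P (coin false) (coin true) (coin false)
  (coin true) coin coin = 1.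
Proof.
rewrite /defect_bound re_integral_coin subr0 (_ : 4^-1 = (4^-1 : R)%:C); last first.
  by rewrite fmorphV/= rmorph_nat.
rewrite normRZ absq_normR normR_coinB ger0_norm ?invr_ge0//.
by rewrite (_ : 4^-1 * 2 ^+ 2 = 1 :> R) ?sqrtr1 ?mulr1//; lra.
Qed.

End FairCoin.

(** * From representatives back to L_2 functions *)

Section GrussL2.
Context (R : realType) d (T : measurableType d) (P : probability T R)
  (A : cstarAlgType R) (X : hilbertModType A).
Implicit Types (f g : T -> X) (x y : X).

Lemma cov_ae f f' g g' : {ae P, forall t, f t = f' t} ->
  {ae P, forall t, g t = g' t} -> cov P f g = cov P f' g'.
Proof.
move=> ff gg; rewrite /cov (bochner_ae ff) (bochner_ae gg); congr (_ - _).
by apply: bochner_ae; apply: filterS2 ff gg => t -> ->.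
Qed.

Lemma variance_ae f f' : {ae P, forall t, f t = f' t} ->
  Defs.variance P f = Defs.variance P f'.
Proof. by move=> ff; exact: cov_ae. Qed.

Lemma re_integral_ae f f' x x' : {ae P, forall t, f t = f' t} ->
  re_integral P x x' f = re_integral P x x' f'.
Proof. by move=> ff; apply: bochner_ae; apply: filterS ff => t ->. Qed.

Lemma sqdist_integral_ae f f' x x' : {ae P, forall t, f t = f' t} ->
  sqdist_integral P x x' f = sqdist_integral P x x' f'.
Proof. by move=> ff; apply: bochner_ae; apply: filterS ff => t ->. Qed.

(** The differences that the two inequalities require to be positive are the same element of [A]. *)
Lemma cle_re_sqdist f x x' : L2 P f ->
  cle 0 (re_integral P x x' f) <->
  cle (sqdist_integral P x x' f) ((4^-1 : R[i]) *: absq (x' - x)).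
Proof.
move=> /L2_sqint[f' fL ff].
rewrite (re_integral_ae _ _ ff) (sqdist_integral_ae _ _ ff) re_integralE//.
by rewrite /cle subr0.
Qed.

Lemma gruss_chain_L2 f g x x' y y' : L2 P f -> L2 P g ->
  cle 0 (re_integral P x x' f) -> cle 0 (re_integral P y y' g) ->
  [/\ normR (cov P f g) <= variance_bound P f g,
      variance_bound P f g <= defect_bound P x x' y y' f g
    & defect_bound P x x' y y' f g <= 4^-1 * (normR (x' - x) * normR (y' - y))].
Proof.
move=> /L2_sqint[f' fL ff] /L2_sqint[g' gL gg].
rewrite /variance_bound /defect_bound (cov_ae ff gg).
rewrite (variance_ae ff) (variance_ae gg).
rewrite (re_integral_ae x x' ff) (re_integral_ae y y' gg).
exact: gruss_chain.
Qed.

End GrussL2.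

Theorem theorem3 (R : realType) :
  (forall (d : measure_display) (T : measurableType d) (P : probability T R)
     (A : cstarAlgType R) (X : hilbertModType A)
     (f g : T -> X) (x x' y y' : X),
     L2 P f -> L2 P g ->
     [/\ cle 0 (re_integral P x x' f) <->
           cle (sqdist_integral P x x' f) ((4^-1 : R[i]) *: absq (x' - x)),
         cle 0 (re_integral P y y' g) <->
           cle (sqdist_integral P y y' g) ((4^-1 : R[i]) *: absq (y' - y))
       & cle 0 (re_integral P x x' f) -> cle 0 (re_integral P y y' g) ->
         [/\ normR (cov P f g) <= variance_bound P f g,
             variance_bound P f g <= defect_bound P x x' y y' f g
           & defect_bound P x x' y y' f g
               <= 4^-1 * (normR (x' - x) * normR (y' - y))]]) /\
  (forall c : R,
     (forall (d : measure_display) (T : measurableType d) (P : probability T R)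
        (A : cstarAlgType R) (X : hilbertModType A)
        (f g : T -> X) (x x' y y' : X),
        L2 P f -> L2 P g ->
        cle 0 (re_integral P x x' f) -> cle 0 (re_integral P y y' g) ->
        variance_bound P f g <= c * defect_bound P x x' y y' f g) ->
     1 <= c) /\
  (forall c : R,
     (forall (d : measure_display) (T : measurableType d) (P : probability T R)
        (A : cstarAlgType R) (X : hilbertModType A)
        (f g : T -> X) (x x' y y' : X),
        L2 P f -> L2 P g ->
        cle 0 (re_integral P x x' f) -> cle 0 (re_integral P y y' g) ->
        defect_bound P x x' y y' f g
          <= c * (normR (x' - x) * normR (y' - y))) ->
     4^-1 <= c).
Proof.
split=> [d T P A X f g x x' y y' fL gL|].
  split; [exact: cle_re_sqdist|exact: cle_re_sqdist|].
  exact: gruss_chain_L2.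
have cL := L2_coin R; have c0 := re_integral_coin_ge0 R.
(* On the coin the two assumptions read 1 <= c and 1 <= c (2 * 2). *)
split=> c H; have := H _ _ _ _ _ _ _ _ _ _ _ cL cL c0 c0.
  by rewrite variance_bound_coin defect_bound_coin mulr1.
by rewrite defect_bound_coin normR_coinB; lra.
Qed.
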